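(* Let $\mathbb{F}$ be a field of characteristic $0$, $m\ge 1$, $n=2m+1$, $c\in\mathbb{F}$. Let $S\subseteq\{1,\dots,n\}$ satisfy: $m+1\notin S$, and for each $i\in\{1,\dots,m\}$ at most one of $i$ and $i+m+1$ lies in $S$. Let $\vec a=(a_1,\dots,a_n)\in\mathbb{F}^n$. Consider the representations $\pi_{c,S}^{\vec a}$ of $sl(n+1,\mathbb{F})=sl(2m+2,\mathbb{F})$ restricted to the subalgebra $sp(2m+2,\mathbb{F})$. (i) If $c\notin-\mathbb{N}$, the restriction of $\pi_{c,\emptyset}^{\vec 0}$ to $sp(2m+2,\mathbb{F})$ is irreducible. If $c\in-\mathbb{N}$, then $\mathscr{A}$, as an $sp(2m+2,\mathbb{F})$-module via $\pi_{c,\emptyset}^{\vec 0}$, has a composition series of length $2$. (ii) If $S\ne\emptyset$ and $c\in\mathbb{F}\setminus\mathbb{Z}$, the restriction of $\pi_{c,S}^{\vec 0}$ to $sp(2m+2,\mathbb{F})$ is irreducible. (iii) Suppose all of the following hold: - $\vec a\neq\vec 0$ and $a_{m+1}=0$; - if $S\cap\{m+2,\dots,2m+1\}\ne\emptyset$, then $a_{i_0}\neq0$ for some $i_0$ with $m+1+i_0\in S$; - if $S\cap\{1,\dots,m+1\}\neq\emptyset$, then $a_{m+1+j_0}\neq 0$ for some $j_0\in S\cap\{1,\dots,m+1\}$. Then the restriction of $\pi_{c,S}^{\vec a}$ to $sp(2m+2,\mathbb{F})$ is irreducible for every $c\in\mathbb{F}$. (iv) For every such $S$ and every $c$, $\mathscr{A}$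 with the restricted representation $\pi_{c,S}^{\vec 0}$ is an infinite-dimensional weight $sp(2m+2,\mathbb{F})$-module with finite-dimensional weight subspaces. Weights are taken relative to the Cartan subalgebra $H=\operatorname{span}\{E_{i,i}-E_{m+1+i,m+1+i}: 1\le i\le m+1\}$.
   Context: Let $E_{r,s}$ denote the $(2m+2)\times(2m+2)$ matrix unit. The symplectic Lie algebra is realized as $$sp(2m+2,\mathbb{F})=\operatorname{span}\{E_{r,m+1+s}+E_{s,m+1+r},\ E_{m+1+r,s}+E_{m+1+s,r}: 1\le r\le s\le m+1\}+\operatorname{span}\{E_{i,j}-E_{m+1+j,m+1+i}: 1\le i,j\le m+1\}\subseteq sl(2m+2,\mathbb{F}).$$ $\mathbb{N}$ denotes the nonnegative integers. Let $\mathscr{A}=\mathbb{F}[x_1,\dots,x_n]$. For $\vec a\in\mathbb{F}^n$ put $\vec a\cdot\vec x=\sum_i a_ix_i$. Let $\mathscr{A}_{\vec a}=\{fe^{\vec a\cdot\vec x}: f\in\mathscr{A}\}$, where $e^{\vec a\cdot\vec x}$ is a formal symbol. The operators act on $\mathscr{A}_{\vec a}$ by - $x_i(fe^{\vec a\cdot \vec x})=(x_if)e^{\vec a\cdot\vec x}$, - $\partial_{x_i}(fe^{\vec a\cdot\vec x})=(\partial_{x_i}f+a_if)e^{\vec a\cdot\vec x}$. In particular $\mathscr{A}_{\vec 0}=\mathscr{A}$. Given $S\subseteq\{1,\dots,n\}$, define operators $X_r,P_r$ as follows: - $X_r=\partial_{x_r}$ and $P_r=-x_r$ if $r\in S$;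 - $X_r=x_r$ and $P_r=\partial_{x_r}$ if $r\notin S$. Put $D_S=\sum_{s=1}^n X_sP_s$ (products taken in the written order). The representation $\pi_{c,S}$ of $sl(n+1,\mathbb{F})$ is defined by the following formulas, for $i\ne j$ in $\{1,\dots,n\}$: - $\pi_{c,S}(E_{i,j})=X_iP_j$, - $\pi_{c,S}(E_{i,n+1})=X_i(D_S+c)$, - $\pi_{c,S}(E_{n+1,i})=-P_i$, - $\pi_{c,S}(E_{i,i}-E_{j,j})=X_iP_i-X_jP_j$, - $\pi_{c,S}(E_{n,n}-E_{n+1,n+1})=D_S+c+X_nP_n$. The representation $\pi_{c,S}$ acting on $\mathscr{A}_{\vec a}$ is denoted $\pi_{c,S}^{\vec a}$. *)

(* Defs.v *)
From HB Require Import structures.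
From mathcomp Require Import all_boot all_order all_algebra.
Set Implicit Arguments. Unset Strict Implicit. Unset Printing Implicit Defensive.
Import GRing.Theory.
Local Open Scope ring_scope.

(* Conventions: variables x_1..x_n are indexed 0-based by 'I_n (x_{i+1} <-> i).
   Matrix indices 1..n+1 are 0-based 'I_n.+1; index n+1 <-> ord_max. *)

Definition mon (n : nat) := {ffun 'I_n -> nat}.
(* Coefficient functions; the polynomial f e^{a.x} in A_a is represented by
   the coefficient function of f (finitely supported, see [polyn]). *)
Definition ser (F : fieldType) (n : nat) := mon n -> F.

Definition zser (F : fieldType) (n : nat) : ser F n := fun _ => 0.

Arguments zser : clear implicits.

Definition polyn (F : fieldType) (n : nat) (f : ser F n) : Prop :=
  exists s : seq (mon n), forall k, k \notin s -> f k = 0.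

Definition upd_mon (n : nat) (k : mon n) (i : 'I_n) (e : nat) : mon n :=
  [ffun j => if j == i then e else k j].

Definition mulx (F : fieldType) (n : nat) (i : 'I_n) (f : ser F n) : ser F n :=
  fun k => if (0 < k i)%N then f (upd_mon k i (k i).-1) else 0.

(* action of \partial_{x_i} on A_a:  f e^{a.x} |-> (\partial_i f + a_i f) e^{a.x} *)
Definition dera (F : fieldType) (n : nat) (a : 'I_n -> F) (i : 'I_n)
  (f : ser F n) : ser F n :=
  fun k => (k i).+1%:R * f (upd_mon k i (k i).+1) + a i * f k.

Definition Xop (F : fieldType) (n : nat) (S : {set 'I_n}) (a : 'I_n -> F)
  (i : 'I_n) (f : ser F n) : ser F n :=
  if i \in S then dera a i f else mulx i f.

Definition Pop (F : fieldType) (n : nat) (S : {set 'I_n}) (a : 'I_n -> F)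
  (i : 'I_n) (f : ser F n) : ser F n :=
  if i \in S then (fun k => - mulx i f k) else dera a i f.

Definition Dop (F : fieldType) (n : nat) (S : {set 'I_n}) (a : 'I_n -> F)
  (f : ser F n) : ser F n :=
  fun k => \sum_(s < n) Xop S a s (Pop S a s f) k.

Definition Dcop (F : fieldType) (n : nat) (c : F) (S : {set 'I_n})
  (a : 'I_n -> F) (f : ser F n) : ser F n :=
  fun k => Dop S a f k + c * f k.

(* pi_{c,S}^a, extended linearly to all (n+1)x(n+1) matrices; on traceless
   matrices it agrees with the defining formulas on the basis of sl(n+1). *)
Definition pi (F : fieldType) (n : nat) (c : F) (S : {set 'I_n})
  (a : 'I_n -> F) (A : 'M[F]_n.+1) (f : ser F n) : ser F n :=
  fun k =>
    \sum_(i < n) \sum_(j < n | i != j)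
        A (inord i) (inord j) * Xop S a i (Pop S a j f) k
  + \sum_(i < n) A (inord i) ord_max * Xop S a i (Dcop c S a f) k
  - \sum_(i < n) A ord_max (inord i) * Pop S a i f k
  + \sum_(i < n) A (inord i) (inord i) *
        (Xop S a i (Pop S a i f) k + Dcop c S a f k).

Definition Emx (F : fieldType) (n r s : nat) : 'M[F]_n.+1 :=
  delta_mx (inord r) (inord s).

Arguments Emx : clear implicits.

Definition idx_pairs (m : nat) : seq (nat * nat) :=
  [seq (r, s) | r <- iota 0 m.+1, s <- iota 0 m.+1].

Definition sp_gens (F : fieldType) (m n : nat) : seq 'M[F]_n.+1 :=
  [seq Emx F n p.1 (m.+1 + p.2) + Emx F n p.2 (m.+1 + p.1)
     | p <- idx_pairs m & (p.1 <= p.2)%N]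
  ++ [seq Emx F n (m.+1 + p.1) p.2 + Emx F n (m.+1 + p.2) p.1
     | p <- idx_pairs m & (p.1 <= p.2)%N]
  ++ [seq Emx F n p.1 p.2 - Emx F n (m.+1 + p.2) (m.+1 + p.1)
     | p <- idx_pairs m].

Arguments sp_gens : clear implicits.

Definition sp (F : fieldType) (m n : nat) : {vspace 'M[F]_n.+1} :=
  <<sp_gens F m n>>%VS.

Arguments sp : clear implicits.

Definition cartan_gen (F : fieldType) (m n : nat) (i : 'I_m.+1) : 'M[F]_n.+1 :=
  Emx F n i i - Emx F n (m.+1 + i) (m.+1 + i).

Arguments cartan_gen : clear implicits.

Definition is_submodule (F : fieldType) (m n : nat) (c : F) (S : {set 'I_n})
  (a : 'I_n -> F) (W : ser F n -> Prop) : Prop :=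
  [/\ (forall f, W f -> polyn f),
      W (zser F n),
      (forall f g, W f -> W g -> W (fun k => f k + g k)),
      (forall (x : F) f, W f -> W (fun k => x * f k)) &
      (forall A f, A \in sp F m n -> W f -> W (pi c S a A f))].

Definition sp_irreducible (F : fieldType) (m n : nat) (c : F) (S : {set 'I_n})
  (a : 'I_n -> F) : Prop :=
  (exists f, polyn f /\ f <> zser F n) /\
  forall W, is_submodule m c S a W ->
    (forall f, W f -> f = zser F n) \/ (forall f, polyn f -> W f).

Definition sp_comp_series_len2 (F : fieldType) (m n : nat) (c : F)
  (S : {set 'I_n}) (a : 'I_n -> F) : Prop :=
  exists W, [/\ is_submodule m c S a W,
    (exists f, W f /\ f <> zser F n),
    (exists f, polyn f /\ ~ W f),
    (forall V, is_submodule m c S a V -> (forall f, V f -> W f) ->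
        (forall f, V f -> f = zser F n) \/ (forall f, W f -> V f)) &
    (forall V, is_submodule m c S a V -> (forall f, W f -> V f) ->
        (forall f, V f -> W f) \/ (forall f, polyn f -> V f))].

Definition in_span (F : fieldType) (n : nat) (s : seq (ser F n)) (f : ser F n)
  : Prop :=
  exists w : 'I_(size s) -> F,
    f = fun k => \sum_(i < size s) w i * nth (zser F n) s i k.

Definition weight_vec (F : fieldType) (m n : nat) (c : F) (S : {set 'I_n})
  (a : 'I_n -> F) (lam : 'I_m.+1 -> F) (f : ser F n) : Prop :=
  polyn f /\
  forall i : 'I_m.+1, pi c S a (cartan_gen F m n i) f = (fun k => lam i * f k).

Arguments weight_vec {F} m {n}.

Definition inf_dim_weight_module_fd (F : fieldType) (m n : nat) (c : F)
  (S : {set 'I_n}) (a : 'I_n -> F) : Prop :=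
  [/\ (forall s : seq (ser F n), exists f, polyn f /\ ~ in_span s f),
      (forall f, polyn f -> exists (r : nat) (lam : 'I_r -> 'I_m.+1 -> F)
          (g : 'I_r -> ser F n),
          (forall j, weight_vec m c S a (lam j) (g j)) /\
          f = (fun k => \sum_(j < r) g j k)) &
      (forall lam : 'I_m.+1 -> F, exists s : seq (ser F n),
          forall f, weight_vec m c S a lam f -> in_span s f)].

(* Main.v *)
(** Write [t] for [x_(m+1)] and [u*] for the partner of a variable [u <> t]. The
    derivation [d_t] lies in [sp(2m+2)], as do, up to sign, [P_u + X_{u*} d_t],
    [t P_u + X_{u*} (D + c)], [t (D + c)] and [X_u P_v - X_{v*} P_{u*}].
    In a nonzero submodule take a nonzero [f] of minimal degree: everything these
    operators send to lower degree vanishes, which makes all the derivatives of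
    [f] vanish, so that [1] belongs to the submodule. When [a = 0], the operators
    [t (D + c)] and [P_{u*} + X_u d_t] then produce all monomials as long as the
    eigenvalues of [D + c] do not vanish; when [a_v <> 0] for a suitable [v] the
    operators [X_u P_v - X_{v*} P_{u*}] and [t P_v + X_{v*} (D + c)] do so for any
    [c]. For [S] empty and [c = -K] the polynomials of degree at most [K] form a
    submodule; a larger submodule contains, by minimality for the grading in which
    [t] has weight 2, a form of degree [K + 1] without [t], then a pure power of a
    variable, and from it all the monomials. *)

Require Import Defs.
From HB Require Import structures.
From mathcomp Require Import boolp functions.
From mathcomp Require Import all_boot all_order all_algebra.
From mathcomp Require Import zify ring.
Set Implicit Arguments.
Unset Strict Implicit.
Unset Printing Implicit Defensive.
(* [Defs] is imported again because [all_algebra] shadows its [polyn]. *)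
Import Defs GRing.Theory.
Local Open Scope ring_scope.

(** The module structure of functions into the regular module lets the operators be declared
    linear. *)
HB.instance Definition _ (F : fieldType) (n : nat) :=
  GRing.Lmodule.copy (ser F n) (mon n -> F^o).

(** * Exponent vectors and weighted degrees *)

Section Monomials.
Variable n : nat.
Implicit Types (k : mon n) (i j : 'I_n) (w : 'I_n -> nat).

Definition addm k i : mon n := upd_mon k i (k i).+1.

Definition mon0 : mon n := [ffun => 0%N].

(** The weights stay arbitrary because several gradings occur: total degree, degree in [t], degree
    with [t] counted twice, and two auxiliary weights. *)
Definition wdeg w k : nat := (\sum_i w i * k i)%N.

Lemma addmE k i j : addm k i j = (k j + (j == i))%N.
Proof. by rewrite ffunE; case: eqP => [->|_]; rewrite ?addn1 ?addn0. Qed.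

Lemma addm_self k i : addm k i i = (k i).+1.
Proof. by rewrite addmE eqxx addn1. Qed.

Lemma addm_neq k i j : j != i -> addm k i j = k j.
Proof. by rewrite addmE => /negPf->; rewrite addn0. Qed.

Lemma addmK k i : upd_mon (addm k i) i (addm k i i).-1 = k.
Proof.
by apply/ffunP => j; rewrite ffunE addm_self /=; case: eqP => [->|/eqP/addm_neq->].
Qed.

Lemma addm_inj i : injective (addm^~ i).
Proof. by move=> k k' e; rewrite -(addmK k i) e addmK. Qed.

Lemma addmC k i j : addm (addm k i) j = addm (addm k j) i.
Proof. by apply/ffunP => l; rewrite !addmE addnAC. Qed.

Lemma addm_pred k i : (0 < k i)%N -> addm (upd_mon k i (k i).-1) i = k.
Proof.
move=> ki; apply/ffunP => j; rewrite !ffunE eqxx.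
by case: eqP => // ->; rewrite prednK.
Qed.

Lemma addm_ex k i : (0 < k i)%N -> exists k', k = addm k' i.
Proof. by move/addm_pred => e; exists (upd_mon k i (k i).-1). Qed.

Lemma mon0_or_addm k : k = mon0 \/ exists i k', k = addm k' i.
Proof.
have [/existsP[i /addm_ex[k' e]]|] := boolP [exists i, (0 < k i)%N].
  by right; exists i, k'.
rewrite negb_exists => /forallP k0; left; apply/ffunP => i; rewrite ffunE.
by apply/eqP; rewrite -leqn0 leqNgt; apply: k0.
Qed.

Lemma wdeg_addm w k i : wdeg w (addm k i) = (wdeg w k + w i)%N.
Proof.
rewrite /wdeg (eq_bigr (fun j => w j * k j + w j * (j == i))%N); last first.
  by move=> j _; rewrite addmE mulnDr.
rewrite big_split /= (bigD1 (P := predT) i) //= [X in (_ + X)%N](bigD1 i) //=.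
rewrite eqxx muln1 [X in (_ + (_ + X))%N]big1 ?addn0 // => j /negPf->.
by rewrite muln0.
Qed.

Lemma wdeg_mon0 w : wdeg w mon0 = 0%N.
Proof. by rewrite /wdeg big1 // => i _; rewrite ffunE muln0. Qed.

Lemma wdeg_pos_addm w k :
  (0 < wdeg w k)%N -> exists i k', (0 < w i)%N /\ k = addm k' i.
Proof.
move=> wk; have [i /andP[wi ki]] : exists i, (0 < w i)%N && (0 < k i)%N.
  apply/existsP; apply: contraTT wk; rewrite negb_exists -eqn0Ngt => /forallP h.
  rewrite /wdeg big1 // => i _; apply/eqP; rewrite muln_eq0.
  by have := h i; case: (w i) (k i) => [|?] [|?].
by have [k' ->] := addm_ex ki; exists i, k'.
Qed.

Lemma wdeg_ge w k i : (w i * k i <= wdeg w k)%N.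
Proof. by rewrite /wdeg (bigD1 i) //= leq_addr. Qed.

End Monomials.
Arguments mon0 {n}.

(** * The basic operators as linear maps *)

Section Operators.
Variables (F : fieldType) (n : nat).
Implicit Types (k : mon n) (i : 'I_n) (f g : ser F n) (a w : 'I_n -> F).

Definition mono k : ser F n := fun k' => (k' == k)%:R.

Definition der i f : ser F n := fun k => (k i).+1%:R * f (addm k i).

Lemma serP f g : (forall k, f k = g k) -> f = g.
Proof. exact: funext. Qed.

Lemma serDE f g k : (f + g) k = f k + g k. Proof. by []. Qed.
Lemma serZE x f k : (x *: f) k = x * f k. Proof. by []. Qed.
Lemma serNE f k : (- f) k = - f k. Proof. by []. Qed.
Lemma ser0E k : (0 : ser F n) k = 0. Proof. by []. Qed.

Lemma ser_sumE (I : Type) (r : seq I) (P : pred I) (G : I -> ser F n) k :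
  (\sum_(i <- r | P i) G i) k = \sum_(i <- r | P i) G i k.
Proof. by elim/big_rec2: _ => // i x y _ <-. Qed.

Definition serE := (serDE, serZE, serNE, ser0E).

Lemma deraE a i f : dera a i f = der i f + a i *: f.
Proof. by []. Qed.

Lemma dera0 i f : dera (fun=> 0) i f = der i f.
Proof. by rewrite deraE scale0r addr0. Qed.

Lemma mulx_addm i f k : mulx i f (addm k i) = f k.
Proof. by rewrite /mulx addmK addm_self. Qed.

Lemma mulx_zero i f k : k i = 0%N -> mulx i f k = 0.
Proof. by rewrite /mulx => ->. Qed.

Lemma mulx_mono i k : mulx i (mono k) = mono (addm k i).
Proof.
apply: serP => k'; case: (posnP (k' i)) => [k0|/addm_ex[{}k' ->]].
  rewrite mulx_zero // /mono; case: eqP => // ek.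
  by move: k0; rewrite ek addm_self.
by rewrite mulx_addm /mono (inj_eq (@addm_inj _ i)).
Qed.

Lemma mulx_inj0 i f : mulx i f = 0 -> f = 0.
Proof. by move=> f0; apply: serP => k; rewrite -(mulx_addm i) f0. Qed.

Lemma der_mono i k : der i (mono (addm k i)) = (k i).+1%:R *: mono k.
Proof.
apply: serP => k'; rewrite /der serZE /mono (inj_eq (@addm_inj _ i)).
by case: eqP => [->|]; rewrite ?mulr0.
Qed.

Lemma der_mono0 i k : k i = 0%N -> der i (mono k) = 0.
Proof.
move=> k0; apply: serP => k'; rewrite /der /mono.
by case: eqP => [e|]; rewrite ?mulr0 //; move: k0; rewrite -e addm_self.
Qed.

Lemma mulx_is_linear i : linear (@mulx F n i).
Proof.
move=> x f g; apply: serP => k; rewrite /mulx !serE.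
by case: ifP; rewrite // mulr0 addr0.
Qed.
HB.instance Definition _ i :=
  GRing.isLinear.Build F (ser F n) (ser F n) *:%R (@mulx F n i)
    (mulx_is_linear i).

Lemma der_is_linear i : linear (der i).
Proof. by move=> x f g; apply: serP => k; rewrite /der !serE; ring. Qed.
HB.instance Definition _ i :=
  GRing.isLinear.Build F (ser F n) (ser F n) *:%R (der i) (der_is_linear i).

Lemma dera_is_linear a i : linear (@dera F n a i).
Proof. by move=> x f g; apply: serP => k; rewrite /dera !serE; ring. Qed.
HB.instance Definition _ a i :=
  GRing.isLinear.Build F (ser F n) (ser F n) *:%R (@dera F n a i)
    (dera_is_linear a i).

Variables (S : {set 'I_n}) (a : 'I_n -> F).

Lemma Xop_is_linear i : linear (Xop S a i).
Proof. by move=> x f g; rewrite /Xop; case: ifP => _; rewrite linearP. Qed.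
HB.instance Definition _ i :=
  GRing.isLinear.Build F (ser F n) (ser F n) *:%R (Xop S a i)
    (Xop_is_linear i).

Lemma PopE i f : Pop S a i f = if i \in S then - mulx i f else dera a i f.
Proof. by []. Qed.

Lemma Pop_is_linear i : linear (Pop S a i).
Proof.
move=> x f g; rewrite !PopE; case: ifP => _; rewrite linearP //.
by rewrite opprD scalerN.
Qed.
HB.instance Definition _ i :=
  GRing.isLinear.Build F (ser F n) (ser F n) *:%R (Pop S a i)
    (Pop_is_linear i).

Lemma DopE f : Dop S a f = \sum_s Xop S a s (Pop S a s f).
Proof. by apply: serP => k; rewrite ser_sumE. Qed.

Lemma DcopE c f : Dcop c S a f = Dop S a f + c *: f.
Proof. by []. Qed.

Lemma Dcop_is_linear c : linear (Dcop c S a).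
Proof.
move=> x f g; rewrite !DcopE !DopE.
under eq_bigr do rewrite !linearP.
rewrite big_split /= -scaler_sumr !scalerDr !scalerA (mulrC c x).
by rewrite -!addrA; congr (_ + _); rewrite addrCA.
Qed.
HB.instance Definition _ c :=
  GRing.isLinear.Build F (ser F n) (ser F n) *:%R (Dcop c S a)
    (Dcop_is_linear c).

End Operators.

(** * Finite boxes of exponents *)

Section Boxes.
Variable n : nat.

Definition box (B : nat) : seq (mon n) :=
  [seq [ffun i => nat_of_ord (z i)] | z : {ffun 'I_n -> 'I_B}].

Lemma box_uniq B : uniq (box B).
Proof.
rewrite /box /image_mem map_inj_uniq ?enum_uniq // => z z' /ffunP e; apply/ffunP => i.
by apply: val_inj; have := e i; rewrite !ffunE.
Qed.

Lemma mem_box B k : (k \in box B) = [forall i, (k i < B)%N].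
Proof.
apply/imageP/forallP => [[z _ ->] i|kB]; first by rewrite ffunE.
exists [ffun i => Ordinal (kB i)] => //.
by apply/ffunP => i; rewrite !ffunE.
Qed.

End Boxes.
Arguments box : clear implicits.

(** * Degree bounds and elements of minimal degree *)

Section Bounds.
Variables (F : fieldType) (n : nat).
Implicit Types (k : mon n) (i : 'I_n) (f g : ser F n) (w : 'I_n -> nat) (d : nat).

(** The bound on the degree is strict, so that bound 0 means vanishing and the zero polynomial needs
    no degree convention. *)
Definition sbnd w d f := forall k, (d <= wdeg w k)%N -> f k = 0.

Lemma sbnd0 w f : sbnd w 0 f -> f = 0.
Proof. by move=> h; apply: serP => k; apply: h. Qed.

Lemma sbndW w d e f : (d <= e)%N -> sbnd w d f -> sbnd w e f.
Proof. by move=> de h k ek; apply: h; apply: leq_trans ek. Qed.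

Lemma sbndD w d f g : sbnd w d f -> sbnd w d g -> sbnd w d (f + g).
Proof. by move=> hf hg k dk; rewrite serE hf ?hg ?addr0. Qed.

Lemma sbndZ w d x f : sbnd w d f -> sbnd w d (x *: f).
Proof. by move=> hf k dk; rewrite serE hf ?mulr0. Qed.

Lemma sbndN w d f : sbnd w d f -> sbnd w d (- f).
Proof. by move=> hf k dk; rewrite serE hf ?oppr0. Qed.

Lemma sbnd_sum w d (I : Type) (r : seq I) (G : I -> ser F n) :
  (forall z, sbnd w d (G z)) -> sbnd w d (\sum_(z <- r) G z).
Proof. by move=> h k dk; rewrite ser_sumE big1 // => z _; apply: h. Qed.

Lemma sbnd_mono w k : sbnd w (wdeg w k).+1 (mono F k).
Proof. by move=> k'; rewrite /mono; case: eqP => // ->; rewrite ltnn. Qed.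

Lemma sbnd_mulx w d i f : sbnd w d f -> sbnd w (d + w i) (mulx i f).
Proof.
move=> hf k; case: (posnP (k i)) => [k0|/addm_ex[{}k ->]].
  by rewrite mulx_zero.
by rewrite wdeg_addm leq_add2r mulx_addm => /hf.
Qed.

(** Truncated subtraction is harmless: when [d <= w i], no monomial of [f] contains the variable and
    the derivative is zero. *)
Lemma sbnd_der w d i f : sbnd w d f -> sbnd w (d - w i) (der i f).
Proof.
by move=> hf k dk; rewrite /der hf ?mulr0 // wdeg_addm addnC -leq_subLR.
Qed.

Lemma sbnd_dera a w d i f : sbnd w d f -> sbnd w d (dera a i f).
Proof.
move=> hf; rewrite deraE; apply: sbndD; last exact: sbndZ.
by apply: sbndW (sbnd_der hf); rewrite leq_subr.
Qed.

Lemma polynP f : polyn f <-> exists d, sbnd (fun=> 1%N) d f.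
Proof.
split=> [[s hs]|[d hd]].
  exists (\max_(k <- s) wdeg (fun=> 1%N) k)%N.+1 => k lk; apply: hs.
  by apply: contraTN lk => ks; rewrite -leqNgt; apply: leq_bigmax_seq.
exists (box n d) => k; rewrite mem_box negb_forall => /existsP[i].
rewrite -leqNgt => dk; apply: hd; apply: leq_trans dk _.
by have := wdeg_ge (fun=> 1%N) k i; rewrite mul1n.
Qed.

Lemma polyn_wbound w f : polyn f -> exists d, sbnd w d f.
Proof.
move=> [s hs]; exists (\max_(k <- s) wdeg w k)%N.+1 => k lk; apply: hs.
by apply: contraTN lk => ks; rewrite -leqNgt; apply: leq_bigmax_seq.
Qed.

Lemma polyn_mono k : polyn (mono F k).
Proof. by apply/polynP; exists (wdeg (fun=> 1%N) k).+1; apply: sbnd_mono. Qed.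

(** The least strict bound met in [C] is positive because [C] excludes zero; hence the form
    [d.+1]. *)
Lemma min_sbnd (C : ser F n -> Prop) w :
    (forall f, C f -> polyn f) -> ~ C 0 -> (exists f, C f) ->
  exists f d, [/\ C f, sbnd w d.+1 f &
                  forall g e, C g -> sbnd w e g -> (d < e)%N].
Proof.
move=> Cpol C0 [f0 Cf0].
pose P d := `[< exists f, C f /\ sbnd w d f >].
have exP : exists d, P d.
  have [d hd] := polyn_wbound w (Cpol _ Cf0).
  by exists d; apply/asboolP; exists f0.
have [d /asboolP[f [Cf fd]] dmin] := ex_minnP exP.
case: d => [|d] in fd dmin *.
  by case: C0; rewrite -(sbnd0 fd).
exists f, d; split=> // g e Cg ge; apply: dmin.
by apply/asboolP; exists g.
Qed.

End Bounds.
Arguments sbnd_mulx {F n w d} i {f} _.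
Arguments sbnd_der {F n w d} i {f} _.
Arguments sbnd_dera {F n} a {w d} i {f} _.
Arguments sbnd_mono {F n} w k.
Arguments mono F {n} k.

(** * Effect of the operators on degrees and monomials *)

Section OperatorBounds.
Variables (F : fieldType) (n : nat) (S : {set 'I_n}) (a : 'I_n -> F).
Implicit Types (f g : ser F n) (k : mon n) (i s : 'I_n) (w : 'I_n -> nat).

Lemma sbnd_Xop w d i f :
  sbnd w d f -> sbnd w (if i \in S then d else d + w i)%N (Xop S a i f).
Proof. by rewrite /Xop; case: ifP => _; [apply: sbnd_dera|apply: sbnd_mulx]. Qed.

Lemma sbnd_Pop w d i f :
  sbnd w d f -> sbnd w (if i \in S then d + w i else d)%N (Pop S a i f).
Proof.
rewrite PopE; case: ifP => _; last exact: sbnd_dera.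
by move=> h; apply/sbndN/sbnd_mulx.
Qed.

(** If [w j] exceeds [d], adding [w i] back after truncation would overshoot [d]; the derivative is
    then zero. *)
Lemma sbnd_mulx_der w d i j f : w i = w j ->
  sbnd w d f -> sbnd w d (mulx i (der j f)).
Proof.
move=> wij; case: (leqP (w j) d) => [wd|dw] hf.
  by have := sbnd_mulx i (sbnd_der j hf); rewrite wij subnK.
suff -> : der j f = 0 by move=> k _; rewrite linear0.
by apply: (@sbnd0 _ _ w); have := sbnd_der j hf; rewrite (eqP (ltnW dw)).
Qed.

Lemma polyn_Xop i f : polyn f -> polyn (Xop S a i f).
Proof.
by move/polynP => [d hd]; apply/polynP; eexists; apply: sbnd_Xop; apply: hd.
Qed.

Lemma polyn_Pop i f : polyn f -> polyn (Pop S a i f).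
Proof.
by move/polynP => [d hd]; apply/polynP; eexists; apply: sbnd_Pop; apply: hd.
Qed.

Lemma polynD f g : polyn f -> polyn g -> polyn (f + g).
Proof.
move=> /polynP[d hd] /polynP[e he]; apply/polynP; exists (maxn d e).
apply: sbndD; [apply: sbndW hd|apply: sbndW he]; lia.
Qed.

Lemma polynZ x f : polyn f -> polyn (x *: f).
Proof. by move=> /polynP[d hd]; apply/polynP; exists d; apply: sbndZ. Qed.

Lemma polyn_Dcop c f : polyn f -> polyn (Dcop c S a f).
Proof.
move=> fp; rewrite DcopE; apply: polynD; last exact: polynZ.
rewrite DopE; elim/big_rec: _ => [|s g _ gp]; last first.
  by apply: polynD => //; apply/polyn_Xop/polyn_Pop.
by apply/polynP; exists 0%N.
Qed.

Lemma sum_mono (r : seq (mon n)) f : uniq r -> (forall k, k \notin r -> f k = 0) ->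
  f = \sum_(k <- r) f k *: mono F k.
Proof.
move=> ur fr; apply: serP => k; rewrite ser_sumE.
have [kr|kr] := boolP (k \in r); last first.
  rewrite (fr _ kr) big1_seq // => k' /andP[_ k'r].
  by cbv beta; rewrite serE /mono; case: eqP kr => [->|]; rewrite ?k'r ?mulr0.
rewrite (bigD1_seq k) //; cbv beta; rewrite serE /mono eqxx mulr1.
rewrite big1 /= ?addr0 // => k' /negPf nk.
by cbv beta; rewrite serE /mono eq_sym nk mulr0.
Qed.

Lemma polyn_sum f : polyn f ->
  exists2 r : seq (mon n), uniq r & f = \sum_(k <- r) f k *: mono F k.
Proof.
move=> [r hr]; exists (undup r); first exact: undup_uniq.
apply: sum_mono => [|k]; first exact: undup_uniq.
by rewrite mem_undup; apply: hr.
Qed.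

(* The eigenvalue of [D_S] on the monomial [x^k] when [a = 0]. *)
Definition ev k : F := \sum_s (if s \in S then - (k s).+1%:R else (k s)%:R).

(** For [s] in [S] the product is minus the derivative of [x_s f], whence the shift by one;
    otherwise it is the Euler operator of [x_s]. *)
Lemma XPop0E s f k : Xop S (fun=> 0) s (Pop S (fun=> 0) s f) k =
  (if s \in S then - (k s).+1%:R else (k s)%:R) * f k.
Proof.
rewrite PopE /Xop !dera0; have [sS|sS] := boolP (s \in S).
  by rewrite /der serE mulx_addm mulrN mulNr.
case: (posnP (k s)) => [k0|/addm_ex[{}k ->]]; first by rewrite mulx_zero ?k0 ?mul0r.
by rewrite mulx_addm addm_self.
Qed.

Lemma Dcop0E c f k : Dcop c S (fun=> 0) f k = (ev k + c) * f k.
Proof.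
rewrite /Dcop /Dop mulrDl; congr (_ + _).
by rewrite mulr_suml; apply: eq_bigr => s _; apply: XPop0E.
Qed.

Lemma Dcop0_mono c k : Dcop c S (fun=> 0) (mono F k) = (ev k + c) *: mono F k.
Proof.
apply: serP => k'; rewrite Dcop0E serE /mono; case: eqP => [->//|_].
by rewrite !mulr0.
Qed.

End OperatorBounds.
Arguments ev {F n} S k.
Arguments sbnd_Xop {F n} S a {w d} i {f} _.
Arguments sbnd_Pop {F n} S a {w d} i {f} _.

(** * Derivatives in characteristic zero *)

Section CharacteristicZero.
Variables (F : fieldType) (n : nat).
Hypothesis charF0 : [pchar F] =i pred0.
Implicit Types (f g : ser F n) (k : mon n) (i : 'I_n).

Lemma natS_neq0 d : d.+1%:R != 0 :> F.
Proof. by have /pcharf0P-> := charF0. Qed.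

Lemma der_eq0 i f k : der i f = 0 -> f (addm k i) = 0.
Proof.
move=> f0; have : der i f k = 0 by rewrite f0.
by move/eqP; rewrite mulf_eq0 (negPf (natS_neq0 _)) => /eqP.
Qed.

Lemma der_all_eq0 f : (forall i, der i f = 0) -> f = f mon0 *: mono F mon0.
Proof.
move=> f0; apply: serP => k; rewrite serE /mono.
case: (mon0_or_addm k) => [->|[i [k' ->]]]; first by rewrite eqxx mulr1.
rewrite (der_eq0 _ (f0 i)); case: eqP => [e|]; last by rewrite mulr0.
by move/ffunP/(_ i): e; rewrite addm_self ffunE.
Qed.

End CharacteristicZero.

(** * Subspaces stable under the symplectic operators *)

Section Stable.
Variables (F : fieldType) (n : nat) (t : 'I_n).
Variables (star : 'I_n -> 'I_n) (sg : 'I_n -> F).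
Implicit Types (f g : ser F n) (k : mon n) (i u v s : 'I_n) (w : 'I_n -> nat).
Implicit Types (c : F) (S : {set 'I_n}) (a : 'I_n -> F) (V : ser F n -> Prop).

(* [t] is the contact variable [x_(m+1)] and [star] exchanges [x_i] and
   [x_(m+1+i)]; the operators are, up to sign and a factor 2, images of
   generators of [sp(2m+2)]. *)
Record stable c S a V : Prop := Stable {
  stable0 : V 0;
  stableD : forall f g, V f -> V g -> V (f + g);
  stableZ : forall x f, V f -> V (x *: f);
  stable_t : forall f, V f -> V (der t f);
  stable_tD : forall f, V f -> V (mulx t (Dcop c S a f));
  stable_H : forall u f, u != t -> V f ->
    V (Pop S a u f + sg u *: Xop S a (star u) (der t f));
  stable_G : forall u f, u != t -> V f ->
    V (mulx t (Pop S a u f) + sg u *: Xop S a (star u) (Dcop c S a f));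
  stable_Q : forall u v f, u != t -> v != t -> V f ->
    V (Xop S a u (Pop S a v f)
       - (sg u * sg v) *: Xop S a (star v) (Pop S a (star u) f)) }.

Section StableTheory.
Variables (c : F) (S : {set 'I_n}) (a : 'I_n -> F) (V : ser F n -> Prop).
Hypothesis stV : stable c S a V.

Lemma stableB f g : V f -> V g -> V (f - g).
Proof.
by move=> Vf Vg; apply: (stableD stV) => //; rewrite -scaleN1r; apply: (stableZ stV).
Qed.

Lemma stable_addlK f g : V (f + g) -> V g -> V f.
Proof. by move=> Vfg Vg; rewrite -(addrK g f); apply: stableB. Qed.

Lemma stable_addrK f g : V (f + g) -> V f -> V g.
Proof. by rewrite addrC; apply: stable_addlK. Qed.

Lemma stableZK x f : x != 0 -> V (x *: f) -> V f.
Proof. by move=> x0 /(stableZ stV x^-1); rewrite scalerA mulVf // scale1r. Qed.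

Lemma stableN f : V (- f) -> V f.
Proof. by rewrite -scaleN1r; apply: stableZK; rewrite oppr_eq0 oner_eq0. Qed.

Lemma stable_sum (I : eqType) (r : seq I) (G : I -> ser F n) :
  (forall z, z \in r -> V (G z)) -> V (\sum_(z <- r) G z).
Proof.
move=> VG; rewrite big_seq; apply: big_ind => //; first exact: stable0 stV.
exact: stableD stV.
Qed.

Lemma stable_span (A : mon n -> Prop) f :
    (forall k, A k -> V (mono F k)) -> polyn f ->
  (forall k, ~ A k -> f k = 0) -> V f.
Proof.
move=> VA /polyn_sum[s _ e] fA; rewrite e; apply: stable_sum => k _.
have [Ak|/fA fk] := pselect (A k); first exact/(stableZ stV)/VA.
by rewrite fk scale0r; apply: stable0 stV.
Qed.

Lemma stable_all f : (forall k, V (mono F k)) -> polyn f -> V f.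
Proof. by move=> VA fp; apply: (@stable_span (fun=> True)) => // k []. Qed.

End StableTheory.

Hypothesis charF0 : [pchar F] =i pred0.
Hypotheses (starK : involutive star) (star_t : star t = t).
Hypothesis (sgN : forall u, u != t -> sg (star u) = - sg u).
Hypothesis (sg2 : forall u, sg u * sg u = 1).

Lemma star_neqt u : u != t -> star u != t.
Proof. by rewrite -{2}star_t (inj_eq (inv_inj starK)). Qed.

Lemma sg_neq0 u : sg u != 0.
Proof. by apply: contra_eq_neq (sg2 u) => ->; rewrite mul0r eq_sym oner_neq0. Qed.

Section Irreducibility.
Variables (c : F) (S : {set 'I_n}) (a : 'I_n -> F) (V : ser F n -> Prop).
Hypothesis stV : stable c S a V.
Hypotheses (tS : t \notin S) (starS : forall u, u \in S -> star u \notin S).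

Lemma minimal_degree : (forall f, V f -> polyn f) -> (exists f, V f /\ f <> 0) ->
  exists f d, [/\ V f, f <> 0, sbnd (fun=> 1%N) d.+1 f &
                  forall g, V g -> sbnd (fun=> 1%N) d g -> g = 0].
Proof.
move=> Vp exV.
have [|[]//|//|f [d [[Vf f0] fd fmin]]] :=
  @min_sbnd _ _ (fun g => V g /\ g <> 0) (fun=> 1%N).
  by move=> f [/Vp].
exists f, d; split=> // g Vg gd; apply: contrapT => g0.
by have := fmin g d (conj Vg g0) gd; rewrite ltnn.
Qed.

Lemma Xop_notin u f : u \notin S -> Xop S a u f = mulx u f.
Proof. by rewrite /Xop => /negPf->. Qed.

Lemma Xop_in u f : u \in S -> Xop S a u f = der u f + a u *: f.
Proof. by rewrite /Xop => ->. Qed.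

Lemma Pop_notin u f : u \notin S -> Pop S a u f = der u f + a u *: f.
Proof. by rewrite PopE => /negPf->. Qed.

Lemma Pop_in u f : u \in S -> Pop S a u f = - mulx u f.
Proof. by rewrite PopE => ->. Qed.

(** Taking [u = star v] in [stable_Q] makes both terms equal, since the two signs are opposite; the
    resulting factor 2 is invertible. *)
Lemma stable_Q2 v f : v != t -> V f -> V (Xop S a (star v) (Pop S a v f)).
Proof.
move=> vt Vf; have := stable_Q stV (star_neqt vt) vt Vf.
rewrite starK sgN // mulNr sg2 scaleN1r opprK -mulr2n -scaler_nat.
by apply: (stableZK stV); apply: (natS_neq0 charF0).
Qed.

(** * The module with nonzero exponent [a] *)

Section Twisted.
Variable v : 'I_n.
Hypotheses (at0 : a t = 0) (vt : v != t) (vS : v \notin S) (av : a v != 0).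
Hypothesis (svS : star v \in S \/ S = set0).

(** For [u] outside [S], [P_u] is the derivative plus a scalar, so the derivative of a minimal [f]
    lies in [V], has lower degree, and vanishes. Then [P_v f = a_v f], and the operators [X_u P_v]
    give the derivatives along [S]. *)
Lemma twisted_mono0 : (forall f, V f -> polyn f) -> (exists f, V f /\ f <> 0) ->
  V (mono F mon0).
Proof.
move=> Vp exV; have [f [d [Vf f0 fd drop]]] := minimal_degree Vp exV.
have dropd i : V (der i f) -> der i f = 0.
  by move=> /drop; apply; have := sbnd_der i fd; rewrite subn1.
have ft : der t f = 0 by apply/dropd/(stable_t stV).
have VfZ x : V (x *: f) by exact: (stableZ stV).
have fS u : u \notin S -> der u f = 0.
  move=> uS; have [->//|ut] := eqVneq u t; apply: dropd.
  have := stable_H stV ut Vf; rewrite ft linear0 scaler0 addr0 Pop_notin //.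
  by move/(stable_addlK stV); apply; apply: VfZ.
have fu u : u \notin S -> Pop S a u f = a u *: f.
  by move=> uS; rewrite Pop_notin // fS // add0r.
have der_of u x : x != 0 -> u \in S -> V (Xop S a u (x *: f)) -> der u f = 0.
  move=> x0 uS; rewrite linearZ /= => /(stableZK stV x0); rewrite Xop_in //.
  by move/(stable_addlK stV)/(_ (VfZ _))/dropd.
have fall u : der u f = 0.
  have [uS|/fS//] := boolP (u \in S).
  have svS' : star v \in S by case: svS uS => // ->; rewrite inE.
  have ut : u != t by apply: contraNneq tS => <-.
  (* The direction [star v] comes first, because [X_{star v}] enters the correction term for every
     other [u]. *)
  have fsv : der (star v) f = 0.
    by apply: (der_of _ _ av svS'); rewrite -fu //; apply: stable_Q2.
  apply: (der_of _ _ av uS); rewrite -fu //.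
  (* The second term is a multiple of [f]: [P_{star u}] acts on [f] by a scalar, and so does
     [X_{star v}] now that [fsv] is known. *)
  have := stable_Q stV ut vt Vf; rewrite -scaleNr.
  move/(stable_addlK stV); apply.
  rewrite (fu (star u)) ?starS // [Xop _ _ _ _]linearZ /= Xop_in // fsv add0r !scalerA.
  exact: VfZ.
have fE := der_all_eq0 charF0 fall; move: Vf; rewrite fE.
apply: (stableZK stV); apply: contra_notN f0 => /eqP f00.
by rewrite fE f00 scale0r.
Qed.

(** Variables in [S] weigh nothing because [P_u] multiplies by them up to sign; [t] is treated by a
    separate induction. *)
Let w u : nat := (u \notin S) && (u != t).

(** For [u] outside [S], the main term of [X_u P_v] is [a_v x_u], which adds the factor [x_u]; all
    the rest is handled by induction on the weight [w]. *)
Lemma twisted_mono_not : V (mono F mon0) -> forall k, k t = 0%N -> V (mono F k).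
Proof.
move=> V0 k; have [d] := ubnP (wdeg w k); elim: d k => // d IHd k kd kt.
(* The induction hypothesis passes from monomials to polynomials; the last bound says that [f] is
   free of [t]. *)
have {}IHd f : polyn f -> sbnd w d f -> sbnd (fun u => (u == t) : nat) 1 f -> V f.
  move=> fp fd ft.
  apply: (stable_span stV (A := fun k => (wdeg w k < d)%N /\ k t = 0%N)) => //.
    by move=> k' [k'd k't]; apply: IHd.
  move=> k' /not_andP[/negP|/eqP]; first by rewrite -leqNgt => /fd.
  rewrite -lt0n => k't; apply: ft; apply: leq_trans (wdeg_ge _ _ t).
  by rewrite eqxx mul1n.
have mono_t k' : k' t = 0%N -> sbnd (fun u => (u == t) : nat) 1 (mono F k').
  move=> k't q qt; rewrite /mono; case: eqP => // e; move: qt; rewrite e.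
  case/wdeg_pos_addm => i [k'' []]; rewrite lt0b => /eqP -> ek.
  by move: k't; rewrite ek addm_self.
(* In weight zero only variables of [S] occur, and [stable_H] multiplies by them, its second term
   being killed by the derivative in [t]. *)
have [kw|kw] := posnP (wdeg w k).
  have [e] := ubnP (wdeg (fun=> 1%N) k).
  elim: e k kw kt {kd} => // e IHe k kw kt ke.
  case: (mon0_or_addm k) => [->//|[i [k' ek]]].
  have it : i != t by apply: contra_eq_neq kt => <-; rewrite ek addm_self.
  move: kw ke kt; rewrite ek !wdeg_addm addm_neq 1?eq_sym // => /eqP.
  rewrite addn_eq0 /w it andbT eqb0 negbK => /andP[/eqP k'w iS] k'e k't.
  have Vk' : V (mono F k') by apply: IHe => //; rewrite addn1 in k'e.
  have := stable_H stV it Vk'.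
  by rewrite der_mono0 // linear0 scaler0 addr0 Pop_in // mulx_mono => /(stableN stV).
have [u [k' []]] := wdeg_pos_addm kw; rewrite lt0b => /andP[uS ut] ek.
have k't : k' t = 0%N by move: kt; rewrite ek addm_neq // eq_sym.
have wu : w u = 1%N by rewrite /w uS ut.
have wv : w v = 1%N by rewrite /w vS vt.
have kd' : sbnd w d (mono F k').
  by apply: sbndW (sbnd_mono w k'); move: kd; rewrite ek wdeg_addm wu; lia.
have Vxd i j : i != t -> j != t -> w i = w j ->
  V (mulx i (der j (mono F k'))).
  move=> it jt wij; apply: IHd; last 2 first.
  - exact: sbnd_mulx_der.
  - by apply: sbnd_mulx_der; rewrite ?(negPf it) ?(negPf jt) //; apply: mono_t.
  case: (posnP (k' j)) => [k0|/addm_ex[k'' ->]].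
    by rewrite der_mono0 // linear0; apply/polynP; exists 0%N.
  by rewrite der_mono linearZ /= mulx_mono; apply/polynZ/polyn_mono.
have Vk' : V (mono F k') by apply: IHd; [apply: polyn_mono|apply: kd'|apply: mono_t].
(* Besides [a_v x_u x^k'], the first term of [stable_Q] contains only [x_u] times a derivative,
   covered by [Vxd]; the second term remains. *)
suff Vt : V (Xop S a (star v) (Pop S a (star u) (mono F k'))).
  have := stable_Q stV ut vt Vk'; rewrite -scaleNr.
  move/(stable_addlK stV)/(_ (stableZ stV _ Vt)).
  rewrite Xop_notin // Pop_notin // linearD linearZ /= mulx_mono -ek.
  move/(stable_addrK stV) => /(_ (Vxd _ _ ut vt _))/(stableZK stV av).
  by apply; rewrite wu wv.
have sut := star_neqt ut; have svt := star_neqt vt.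
(* If [star v] is in [S], neither [X_{star v}] nor [P_{star u}] raises the weight. *)
case: svS => [svS'|S0].
  apply: IHd; first exact/polyn_Xop/polyn_Pop/polyn_mono.
    have := sbnd_Xop S a (star v) (sbnd_Pop S a (star u) kd').
    by rewrite svS' /w; case: (star u \in S); rewrite ?addn0.
  have := sbnd_Xop S a (star v) (sbnd_Pop S a (star u) (mono_t _ k't)).
  by rewrite svS' (negPf sut) !addn0; case: ifP.
(* For empty [S], [x_{star v}] raises the weight, but [stable_Q2] produces
   [a_{star u} x_{star v} x^k'] up to terms of the weight of [k']. *)
have nS x : x \notin S by rewrite S0 inE.
have w1 x : x != t -> w x = 1%N by rewrite /w nS => ->.
rewrite Xop_notin // Pop_notin // linearD linearZ /= mulx_mono.
apply: (stableD stV); first by apply: Vxd; rewrite ?w1.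
apply: (stableZ stV); have := stable_Q2 vt Vk'.
rewrite Xop_notin // Pop_notin // linearD linearZ /= mulx_mono.
by move/(stable_addrK stV) => /(_ (Vxd _ _ svt vt _))/(stableZK stV av); apply; rewrite !w1.
Qed.

(** The main term of [t P_v + X_{star v} (D + c)] is [a_v t]. Its companion with the derivative
    along [v] has a smaller exponent of [v], and the part with [D + c] a smaller exponent of [t];
    hence the nested induction. *)
Lemma twisted_mono : V (mono F mon0) -> forall k, V (mono F k).
Proof.
move=> V0 k; have [d] := ubnP (k t); elim: d k => // d IHd k kd.
have [kt|/addm_ex[q ek]] := posnP (k t); first exact: twisted_mono_not.
have {kd} : (q t < d)%N by rewrite ek addm_self in kd.
rewrite {}ek; have [e] := ubnP (q v); elim: e q => // e IHe q qe qd.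
have IH f : polyn f -> sbnd (fun u => (u == t) : nat) d f -> V f.
  move=> fp fd; apply: (stable_span stV (A := fun k => (k t < d)%N)) => //.
  move=> k' /negP; rewrite -leqNgt => dk; apply: fd; apply: leq_trans dk _.
  by have := wdeg_ge (fun u => (u == t) : nat) k' t; rewrite eqxx mul1n.
have qb : sbnd (fun u => (u == t) : nat) d (mono F q).
  apply: sbndW (sbnd_mono _ q); rewrite /wdeg (bigD1 t) //= eqxx mul1n.
  by rewrite big1 ?addn0 // => i /negPf->.
have svt := star_neqt vt.
(* Here [a t = 0] matters: the summand of [D] at [t] is then the Euler operator, which does not
   raise the degree in [t]. *)
have Dq : sbnd (fun u => (u == t) : nat) d (Dcop c S a (mono F q)).
  rewrite DcopE; apply: sbndD; last exact: sbndZ.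
  rewrite DopE; apply: sbnd_sum => z; have [->|zt] := eqVneq z t.
    rewrite Xop_notin // Pop_notin // at0 scale0r addr0.
    exact: sbnd_mulx_der.
  have := sbnd_Xop S a z (sbnd_Pop S a z qb).
  by rewrite (negPf zt) !addn0; case: (z \in S).
have VD : V (sg v *: Xop S a (star v) (Dcop c S a (mono F q))).
  apply: (stableZ stV); apply: IH; first exact/polyn_Xop/polyn_Dcop/polyn_mono.
  by have := sbnd_Xop S a (star v) Dq; rewrite (negPf svt) addn0; case: ifP.
have := stable_addlK stV (stable_G stV vt (IHd _ qd)) VD.
rewrite Pop_notin // linearD linearZ /= mulx_mono => /(stable_addrK stV) Vq.
apply: (stableZK stV av); apply: Vq.
have [q0|/addm_ex[q' eq]] := posnP (q v).
  by rewrite der_mono0 // linear0; apply: (stable0 stV).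
rewrite eq der_mono linearZ /= mulx_mono; apply: (stableZ stV); apply: IHe.
  by rewrite eq addm_self in qe.
by rewrite eq addm_neq // eq_sym in qd.
Qed.

End Twisted.
End Irreducibility.

(** * The module with [a = 0] *)

Section Untwisted.
Variables (c : F) (S : {set 'I_n}) (V : ser F n -> Prop).
Hypothesis stV : stable c S (fun=> 0) V.
Hypotheses (tS : t \notin S) (starS : forall u, u \in S -> star u \notin S).

(** Outside [S] the derivatives of a minimal [f] vanish by [stable_H]. Along [u] in [S] one gets
    that the derivative of [(D + c) f] vanishes, and [D + c] is diagonal with nonzero
    eigenvalues. *)
Lemma untwisted_mono0 : (forall u k, u \in S -> ev S k + c != 0) ->
    (forall f, V f -> polyn f) -> (exists f, V f /\ f <> 0) ->
  V (mono F mon0).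
Proof.
move=> evS Vp exV; have [f [d [Vf f0 fd drop]]] := minimal_degree Vp exV.
have dropd i : V (der i f) -> der i f = 0.
  by move=> /drop; apply; have := sbnd_der i fd; rewrite subn1.
have ft : der t f = 0 by apply/dropd/(stable_t stV).
have fS u : u \notin S -> der u f = 0.
  move=> uS; have [->//|ut] := eqVneq u t; apply: dropd.
  have := stable_H stV ut Vf; rewrite ft linear0 scaler0 addr0 Pop_notin //.
  by rewrite scale0r addr0.
have fall u : der u f = 0.
  have [uS|/fS//] := boolP (u \in S).
  have ut : u != t by apply: contraNneq tS => <-.
  (* Since [star u] lies outside [S], the term with [t] vanishes and only [X_u (D + c) f]
     survives. *)
  have := stable_G stV (star_neqt ut) Vf.
  rewrite Pop_notin ?starS // fS ?starS // scale0r addr0 linear0 add0r starK.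
  move/(stableZK stV (sg_neq0 _)); rewrite Xop_in // scale0r addr0 => /drop g0.
  have {}g0 : der u (Dcop c S (fun=> 0) f) = 0.
    apply: g0; have : sbnd (fun=> 1%N) d.+1 (Dcop c S (fun=> 0) f).
      by move=> k kd; rewrite Dcop0E fd ?mulr0.
    by move/(sbnd_der u); rewrite subn1.
  apply: serP => k; rewrite /der; have := der_eq0 charF0 k g0.
  rewrite Dcop0E => /eqP; rewrite mulf_eq0 (negPf (evS _ _ uS)) => /eqP->.
  by rewrite mulr0.
have fE := der_all_eq0 charF0 fall; move: Vf; rewrite fE.
apply: (stableZK stV); apply: contra_notN f0 => /eqP f00.
by rewrite fE f00 scale0r.
Qed.

(** Factors in [S] are created by [P_u], then factors [t] by [t (D + c)], and finally each other
    [x_u] is exchanged for a [t]. The predicate [Q] restricts the target, so that the result also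
    serves for the polynomials of degree at most [K], where an eigenvalue vanishes at the top. *)
Lemma untwisted_mono (Q : mon n -> Prop) :
    (forall k, Q (addm k t) -> ev S k + c != 0) ->
    (forall k u, Q (addm k u) -> Q k) ->
    (forall k u, Q (addm k u) -> Q (addm k t)) ->
    (forall k u, u \in S -> Q k -> Q (addm k u)) ->
  V (mono F mon0) -> forall k, Q k -> V (mono F k).
Proof.
move=> Qev Qpred Qt QS V0 k; pose w u : nat := (u \notin S) && (u != t).
have [d] := ubnP (wdeg w k); elim: d k => // d IHd k kd Qk.
have [kw|kw] := posnP (wdeg w k).
  have [e] := ubnP (wdeg (fun=> 1%N) k).
  elim: e k kw Qk {kd} => // e IHe k kw Qk ke.
  have [kt|/addm_ex[q ek]] := posnP (k t); last first.
    move: kw ke Qk; rewrite {}ek !wdeg_addm /w eqxx andbF addn0 addn1 => qw qe Qq.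
    have := stable_tD stV (IHe _ qw (Qpred _ _ Qq) qe).
    rewrite Dcop0_mono linearZ /= mulx_mono.
    by apply: (stableZK stV); apply: Qev.
  case: (mon0_or_addm k) => [->//|[i [k' ek]]].
  have it : i != t by apply: contra_eq_neq kt => <-; rewrite ek addm_self.
  move: kw ke kt Qk; rewrite ek !wdeg_addm addm_neq 1?eq_sym // => /eqP.
  rewrite addn_eq0 /w it andbT eqb0 negbK => /andP[/eqP k'w iS] k'e k't Qk.
  have Vk' : V (mono F k').
    by apply: IHe => //; [apply: Qpred Qk|rewrite addn1 in k'e].
  have := stable_H stV it Vk'.
  by rewrite der_mono0 // linear0 scaler0 addr0 Pop_in // mulx_mono => /(stableN stV).
have [u [q []]] := wdeg_pos_addm kw; rewrite lt0b => /andP[uS ut] ek.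
have sut := star_neqt ut.
move: kd Qk; rewrite {}ek wdeg_addm {2}/w uS ut addn1 => qd Qk.
have Qqt := Qt _ _ Qk.
(* As [t] has weight zero, [x^q t] precedes [x^q x_u] in the induction; [stable_H] for [star u]
   turns its [t] into [x_u]. *)
have wt : w t = 0%N by rewrite /w eqxx andbF.
have wqt : (wdeg w (addm q t) < d)%N by rewrite wdeg_addm wt addn0.
have Vqt := IHd _ wqt Qqt.
have := stable_H stV sut Vqt; rewrite starK Xop_notin // der_mono linearZ /= mulx_mono.
rewrite scalerA => /(stable_addrK stV) V1.
apply: (stableZK stV) (V1 _).
  by rewrite mulf_neq0 ?sg_neq0 ?(natS_neq0 charF0).
(* The leftover [P_{star u}] multiplies by a variable of weight zero or differentiates, so the
   induction covers it. *)
have [suS|suS] := boolP (star u \in S).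
  rewrite Pop_in // mulx_mono -scaleN1r; apply: (stableZ stV); apply: IHd.
    by rewrite wdeg_addm {2}/w suS addn0.
  exact: QS.
rewrite Pop_notin // scale0r addr0.
have [k0|/addm_ex[q' eq]] := posnP (addm q t (star u)).
  by rewrite der_mono0 //; apply: (stable0 stV).
rewrite eq der_mono; apply: (stableZ stV); apply: IHd.
  by move: wqt; rewrite eq wdeg_addm; apply: leq_ltn_trans; apply: leq_addr.
by rewrite eq in Qqt; apply: Qpred Qqt.
Qed.

End Untwisted.
End Stable.

(** * The quotient by the polynomials of degree at most [K] *)

Section Quotient.
Variables (F : fieldType) (n : nat) (t : 'I_n).
Variables (star : 'I_n -> 'I_n) (sg : 'I_n -> F).
Implicit Types (f g : ser F n) (k q : mon n) (i u v s : 'I_n).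
Hypothesis charF0 : [pchar F] =i pred0.
Hypotheses (starK : involutive star) (star_t : star t = t).
Hypothesis (sgN : forall u, u != t -> sg (star u) = - sg u).
Hypothesis (sg2 : forall u, sg u * sg u = 1).
Variables (K : nat) (V : ser F n -> Prop) (u0 : 'I_n).
Hypothesis stV : stable t star sg (- K%:R) set0 (fun=> 0) V.
Hypothesis ut0 : u0 != t.

Local Notation deg := (wdeg (fun=> 1%N)).

Let star_nt u : u != t -> star u != t.
Proof. exact: star_neqt. Qed.

Let nS u : u \notin (set0 : {set 'I_n}).
Proof. by rewrite inE. Qed.

Lemma sg_pm u v : sg u != sg v -> sg u = - sg v.
Proof.
move=> /negPf uv; apply/eqP; rewrite -addr_eq0.
have: (sg u - sg v) * (sg u + sg v) == 0 by rewrite -subr_sqr !expr2 !sg2 subrr.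
by rewrite mulf_eq0 subr_eq0 uv.
Qed.

Lemma star_sg_neq u : u != t -> sg (star u) != sg u.
Proof.
move=> ut; rewrite sgN // eq_sym -addr_eq0 -mulr2n -mulr_natl mulf_eq0.
by rewrite (negPf (natS_neq0 charF0 _)) (negPf (sg_neq0 sg2 _)).
Qed.

Lemma star_neq u : u != t -> star u != u.
Proof. by move=> ut; apply: contraNneq (star_sg_neq ut) => ->. Qed.

Lemma deg_addm k i : deg (addm k i) = (deg k).+1.
Proof. by rewrite wdeg_addm addn1. Qed.

Lemma ev_set0 k : ev set0 k = (deg k)%:R :> F.
Proof.
rewrite /ev /wdeg natr_sum; apply: eq_bigr => i _.
by rewrite inE mul1n.
Qed.

Lemma stable_H0 u f : u != t -> V f -> V (der u f + sg u *: mulx (star u) (der t f)).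
Proof.
by move=> ut Vf; have := stable_H stV ut Vf; rewrite Pop_notin // Xop_notin // scale0r addr0.
Qed.

Lemma stable_Q0 u v f : u != t -> v != t -> V f ->
  V (mulx u (der v f) - (sg u * sg v) *: mulx (star v) (der (star u) f)).
Proof.
move=> ut vt Vf; have := stable_Q stV ut vt Vf.
by rewrite !Pop_notin // !Xop_notin // !scale0r !addr0.
Qed.

Lemma stable_Q20 v f : v != t -> V f -> V (mulx (star v) (der v f)).
Proof.
move=> vt Vf; have := stable_Q2 charF0 starK star_t sgN sg2 stV vt Vf.
by rewrite Pop_notin // Xop_notin // scale0r addr0.
Qed.

(** These forms represent the bottom of the quotient; the symplectic operators in the variables
    other than [t] preserve them. *)
Definition head_degree f := forall k, ~ (deg k = K.+1 /\ k t = 0%N) -> f k = 0.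

Lemma head_degree_exists :
    (forall f, V f -> polyn f) -> (forall f, sbnd (fun=> 1%N) K.+1 f -> V f) ->
    (exists f, V f /\ ~ sbnd (fun=> 1%N) K.+1 f) ->
  exists f, [/\ V f, f <> 0 & head_degree f].
Proof.
(* With weight 2 on [t], both terms of [stable_H0] lower the degree by exactly one. *)
move=> Vp VW exV; pose ct u := if u == t then 2%N else 1%N.
have [|||f [d [[Vf fW] fd fmin]]] :=
  @min_sbnd _ _ (fun g => V g /\ ~ sbnd (fun=> 1%N) K.+1 g) ct.
- by move=> f [/Vp].
- by move=> [_]; apply.
- exact: exV.
have drop g : V g -> sbnd ct d g -> sbnd (fun=> 1%N) K.+1 g.
  move=> Vg gd; apply: contrapT => gW.
  by have := fmin g d (conj Vg gW) gd; rewrite ltnn.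
have d0 : (0 < d)%N.
  rewrite lt0n; apply/eqP => d0; apply: fW => k kK; apply: fd; rewrite d0.
  have [i [q [_ ->]]] := wdeg_pos_addm (leq_trans (ltn0Sn _) kK).
  by rewrite wdeg_addm /ct; case: ifP; rewrite ?addn1 ?addn2.
have HW u : u != t -> sbnd (fun=> 1%N) K.+1 (der u f + sg u *: mulx (star u) (der t f)).
  move=> ut; apply: drop; first exact: stable_H0.
  apply: sbndD; first by have := sbnd_der u fd; rewrite /ct (negPf ut) subn1.
  apply: sbndZ; have := sbnd_mulx (star u) (sbnd_der t fd).
  by rewrite /ct eqxx (negPf (star_nt ut)); apply: sbndW; lia.
(* Two coefficients, one of [HW] for [u0] and one for [star u0], involve the same two unknowns [x]
   and [y], with opposite signs at [y]. Their sum is a positive multiple of [x]. *)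
have tail_t k : (K <= deg k)%N -> f (addm k t) = 0.
  move=> kK; have su0 := star_neq ut0; have st0 := star_nt ut0.
  have e1 := HW _ ut0 (addm k (star u0)).
  have e2 := HW _ st0 (addm k u0); rewrite starK in e2.
  rewrite !serE mulx_addm /der addm_neq 1?eq_sym // deg_addm in e1.
  rewrite !serE mulx_addm /der addm_neq // deg_addm addmC in e2.
  have {}e1 := e1 kK; have {}e2 := e2 kK; rewrite sgN // in e2.
  set x := f (addm (addm k _) _) in e1 e2; set y := f _ in e1 e2 *.
  have x0 : x = 0.
    have: ((k u0 + k (star u0)).+2%:R * x) == 0.
      apply/eqP; rewrite -[RHS]addr0 -[X in X + _]e1 -[X in _ + X]e2.
      by rewrite -addn2 !natrD -!natr1; ring.
    by rewrite mulf_eq0 (negPf (natS_neq0 charF0 _)) => /eqP.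
  move/eqP: e1; rewrite x0 mulr0 add0r !mulf_eq0 (negPf (natS_neq0 charF0 _)).
  by rewrite (negPf (sg_neq0 sg2 _)) => /eqP.
(* The discarded part has degree at most [K] and lies in [V] by [VW]. *)
pose f' : ser F n := fun k => if (K < deg k)%N then f k else 0.
have Wf' : sbnd (fun=> 1%N) K.+1 (f - f').
  by move=> k kK; rewrite !serE /f' kK subrr.
exists f'; split.
- by rewrite -[f'](subKr f); apply: (stableB stV) => //; apply: VW.
- by move=> f'0; apply: fW; move: Wf'; rewrite f'0 subr0.
move=> k kh; rewrite /f'; case: ltnP => // kK.
have [kt|/addm_ex[q ek]] := posnP (k t); last first.
  by rewrite ek tail_t //; rewrite ek deg_addm in kK.
have {kh} kK1 : (K.+1 < deg k)%N.
  by rewrite ltn_neqAle kK andbT; apply/eqP => dk; apply: kh.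
have [u [q [_ ek]]] := wdeg_pos_addm (leq_trans (ltn0Sn _) kK).
have ut : u != t by apply: contra_eq_neq kt => <-; rewrite ek addm_self.
(* Above degree [K + 1] the coefficient of [HW] at [q] is still zero, and its part with [t] is
   removed by [tail_t]. *)
rewrite ek deg_addm ltnS in kK1; have := HW _ ut q kK1; rewrite !serE ek /der.
suff -> : mulx (star u) (der t f) q = 0.
  rewrite mulr0 addr0 => /eqP; rewrite mulf_eq0.
  by rewrite (negPf (natS_neq0 charF0 _)) => /eqP.
have [q0|/addm_ex[q' eq]] := posnP (q (star u)); first by rewrite mulx_zero.
rewrite eq mulx_addm /der tail_t ?mulr0 //.
by rewrite eq deg_addm in kK1.
Qed.

Definition pure : mon n := [ffun i => if i == u0 then K.+1 else 0%N].

Lemma head_pure k : deg k = K.+1 ->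
  (forall v, v != u0 -> k v = 0%N) -> k = pure.
Proof.
move=> dk kv; apply/ffunP => i; rewrite ffunE; case: eqP => [->|/eqP/kv//].
rewrite -dk /wdeg (bigD1 u0) //= mul1n big1 ?addn0 // => v /kv ->.
by rewrite muln0.
Qed.

(* The raising operators of [sp(2m)] strictly decrease this weight, whose
   minimum on the monomials of a given degree without [t] is at the powers of
   the variable [u0]. *)
Let phi u : nat :=
  if (u == t) || (u == u0) then 0%N else if sg u == sg u0 then 1%N else 2%N.

Lemma head_degree_move u v f : u != t -> v != t ->
  head_degree f -> head_degree (mulx u (der v f)).
Proof.
move=> ut vt hf k kh; have [k0|/addm_ex[q ek]] := posnP (k u).
  by rewrite mulx_zero.
rewrite ek mulx_addm /der hf ?mulr0 // => -[].
rewrite deg_addm !addm_neq 1?eq_sym // => dq qt; apply: kh.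
by rewrite ek deg_addm addm_neq 1?eq_sym.
Qed.

(** In a form of minimal [phi]-degree, any operator [x_u d_v] of [V] that lowers [phi] forces the
    derivative along [v] to vanish. Only the power of [u0] survives. *)
Lemma pure_in_stable :
    (forall f, V f -> polyn f) -> (exists f, [/\ V f, f <> 0 & head_degree f]) ->
  V (mono F pure).
Proof.
move=> Vp exV.
have [|||f [d [[Vf f0 fh] fd fmin]]] :=
  @min_sbnd _ _ (fun g => [/\ V g, g <> 0 & head_degree g]) phi.
- by move=> f [/Vp].
- by case.
- exact: exV.
have drop u v : u != t -> v != t -> (phi u < phi v)%N ->
    V (mulx u (der v f)) -> der v f = 0.
  move=> ut vt uv Vg; apply: contrapT => g0.
  suff : (d < d)%N by rewrite ltnn.
  apply: (fmin (mulx u (der v f))).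
    by split=> //; [move/mulx_inj0|apply: head_degree_move].
  have [vd|dv] := leqP (phi v) d.+1.
    by apply: sbndW (sbnd_mulx u (sbnd_der v fd)); lia.
  case: g0; apply: (@sbnd0 _ _ phi).
  by have := sbnd_der v fd; rewrite (eqP (ltnW dv)).
(* The partner of such a [v] has the sign of [u0], so the weight drops from 2 to at most 1. *)
have low v : v != t -> sg v != sg u0 -> der v f = 0.
  move=> vt sv; apply: (drop (star v)) (stable_Q20 vt Vf) => //; first exact: star_nt.
  have vu0 : v != u0 by apply: contraNneq sv => ->.
  rewrite /phi (negPf vt) (negPf (star_nt vt)) (negPf vu0) (negPf sv) /=.
  by rewrite sgN // (sg_pm sv) opprK eqxx; case: ifP.
(* Among variables with the sign of [u0], [v] is replaced by [u0]; the second term of [stable_Q0]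
   dies by [low] at [star u0]. *)
have fv v : v != t -> v != u0 -> der v f = 0.
  move=> vt vu0; have [sv|/low->//] := eqVneq (sg v) (sg u0).
  apply: (drop u0) => //.
    by rewrite /phi eqxx orbT (negPf vt) (negPf vu0) sv eqxx.
  have := stable_Q0 ut0 vt Vf; rewrite (low (star u0)) ?star_nt ?star_sg_neq //.
  by rewrite linear0 scaler0 subr0.
have fE : f = f pure *: mono F pure.
  apply: serP => k; rewrite serE /mono; case: eqP => [->|kp]; rewrite ?mulr1 ?mulr0 //.
  have [[dk kt]|/fh//] := pselect (deg k = K.+1 /\ k t = 0%N).
  have [/existsP[v /andP[vu0 kv]]|] := boolP [exists v, (v != u0) && (0 < k v)%N].
    have vt : v != t by apply: contraTneq kv => ->; rewrite kt.
    by have [q ->] := addm_ex kv; apply: (der_eq0 charF0); apply: fv.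
  rewrite negb_exists => /forallP kv; case: kp; apply: head_pure => // v vu0.
  by have := kv v; rewrite vu0 -eqn0Ngt => /eqP.
move: Vf; rewrite fE; apply: (stableZK stV).
by apply: contra_notN f0 => /eqP f00; rewrite fE f00 scale0r.
Qed.

(** The moves of [pure_in_stable] are run backwards: a variable of the other sign is obtained from
    its partner, one of the same sign from [u0]. *)
Lemma head_mono : V (mono F pure) ->
  forall k, deg k = K.+1 -> k t = 0%N -> V (mono F k).
Proof.
move=> Vpure k; have [d] := ubnP (wdeg phi k); elim: d k => // d IHd k kd dk kt.
have [/existsP[v /andP[sv kv]]|nsv] := boolP [exists v, (sg v != sg u0) && (0 < k v)%N].
  have vt : v != t by apply: contraTneq kv => ->; rewrite kt.
  have vu0 : v != u0 by apply: contraNneq sv => ->.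
  have [q ek] := addm_ex kv; have qt : q t = 0%N by rewrite ek addm_neq // eq_sym in kt.
  have Vq : V (mono F (addm q (star v))).
    apply: IHd; last by rewrite addm_neq // eq_sym star_nt.
      apply: leq_trans (_ : wdeg phi k <= d)%N => //; rewrite ek !wdeg_addm ltn_add2l.
      rewrite /phi (negPf vt) (negPf (star_nt vt)) (negPf vu0) (negPf sv) /=.
      by rewrite sgN // (sg_pm sv) opprK eqxx; case: ifP.
    by rewrite -dk ek !deg_addm.
  have := stable_Q20 (star_nt vt) Vq; rewrite starK der_mono linearZ /= mulx_mono -ek.
  by apply: (stableZK stV); apply: natS_neq0.
have {}nsv v : sg v != sg u0 -> k v = 0%N.
  move=> sv; apply/eqP; rewrite eqn0Ngt; apply: contra nsv => kv.
  by apply/existsP; exists v; rewrite sv.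
have [/existsP[v /andP[vu0 kv]]|] := boolP [exists v, (v != u0) && (0 < k v)%N].
  have vt : v != t by apply: contraTneq kv => ->; rewrite kt.
  have sv : sg v = sg u0 by apply/eqP; apply: contraLR kv => /nsv->.
  have [q ek] := addm_ex kv; have qt : q t = 0%N by rewrite ek addm_neq // eq_sym in kt.
  have Vq : V (mono F (addm q u0)).
    apply: IHd; last by rewrite addm_neq // eq_sym.
      apply: leq_trans (_ : wdeg phi k <= d)%N => //; rewrite ek !wdeg_addm ltn_add2l.
      by rewrite /phi eqxx orbT (negPf vt) (negPf vu0) sv eqxx.
    by rewrite -dk ek !deg_addm.
  (* The correction term vanishes: [star v] has the sign opposite to [u0], and no such variable is
     left. *)
  have := stable_Q0 vt ut0 Vq; rewrite (der_mono0 _ (i := star v)).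
    rewrite linear0 scaler0 subr0 der_mono linearZ /= mulx_mono -ek.
    by apply: (stableZK stV); apply: natS_neq0.
  have ssv := star_sg_neq vt; rewrite sv in ssv.
  rewrite addm_neq; last by apply: contraNneq ssv => ->.
  by have := nsv _ ssv; rewrite ek addm_neq // star_neq.
rewrite negb_exists => /forallP kv; rewrite (head_pure dk) // => v vu0.
by have := kv v; rewrite vu0 -eqn0Ngt => /eqP.
Qed.

(** On a monomial of degree [K + 1], [D - K] acts as 1. Adding [stable_G] for [u0] and [star u0]
    cancels the terms without the new [t] and leaves a positive multiple of [x^q t]. *)
Lemma degree_head_mono : V (mono F pure) ->
  forall k, deg k = K.+1 -> V (mono F k).
Proof.
move=> Vpure k; have [d] := ubnP (k t); elim: d k => // d IHd k kd dk.
have [kt|/addm_ex[q ek]] := posnP (k t); first exact: head_mono.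
move: kd dk; rewrite ek addm_self deg_addm => qd [dq].
have VG u : u != t -> V ((q u).+1%:R *: mono F (addm q t)
    + sg u *: mono F (addm (addm q u) (star u))).
  move=> ut; have Vq : V (mono F (addm q u)).
    by apply: IHd; rewrite ?deg_addm ?dq // addm_neq // eq_sym.
  have := stable_G stV ut Vq; rewrite Pop_notin // Xop_notin // scale0r addr0.
  rewrite der_mono Dcop0_mono !linearZ /= !mulx_mono ev_set0 deg_addm dq.
  by rewrite (_ : K.+1%:R - K%:R = 1) ?scale1r // -natr1 addrC addKr.
have := stableD stV (VG _ ut0) (VG _ (star_nt ut0)).
rewrite starK sgN // (addmC q (star u0)) scaleNr addrACA subrr addr0 -scalerDl -natrD.
by apply: (stableZK stV); rewrite addnS; apply: natS_neq0.
Qed.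

(** In degree [K + 1 + e] the eigenvalue of [D - K] is [e + 1], nonzero, so [t (D - K)] reaches the
    next degree; a [t] is then exchanged for any other variable. *)
Lemma quotient_mono : V (mono F pure) ->
    (forall f, sbnd (fun=> 1%N) K.+1 f -> V f) ->
  forall k, V (mono F k).
Proof.
move=> Vpure VW k; have [kK|Kk] := leqP (deg k) K.
  by apply: VW; apply: sbndW (sbnd_mono _ k).
have [e] : exists e, deg k = (K.+1 + e)%N by exists (deg k - K.+1)%N; lia.
elim: e k {Kk} => [|e IHe] k.
  by rewrite addn0; apply: degree_head_mono.
have Vt q : deg (addm q t) = (K.+1 + e.+1)%N -> V (mono F (addm q t)).
  rewrite deg_addm addnS => -[dq]; have := stable_tD stV (IHe q dq).
  rewrite Dcop0_mono linearZ /= mulx_mono; apply: (stableZK stV).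
  by rewrite ev_set0 dq addSn -addnS natrD addrAC subrr add0r natS_neq0.
move=> dk; have [kt|/addm_ex[q ek]] := posnP (k t); last by rewrite ek; apply: Vt; rewrite -ek.
have [u [q [_ ek]]] : exists i q, (0 < 1)%N /\ k = addm q i.
  by apply: (@wdeg_pos_addm _ (fun=> 1%N)); rewrite dk.
have ut : u != t by apply: contra_eq_neq kt => <-; rewrite ek addm_self.
have Vq : V (mono F (addm q t)) by apply: Vt; rewrite -dk ek !deg_addm.
have := stable_H0 (star_nt ut) Vq; rewrite starK der_mono linearZ /= mulx_mono -ek scalerA.
move=> /(stable_addrK stV) V1; apply: (stableZK stV) (V1 _).
  by rewrite mulf_neq0 ?natS_neq0 // sg_neq0.
have [q0|/addm_ex[q' eq]] := posnP (addm q t (star u)).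
  by rewrite der_mono0 //; apply: (stable0 stV).
rewrite eq der_mono; apply: (stableZ stV); apply: IHe.
apply/succn_inj; rewrite -(deg_addm q' (star u)) -eq deg_addm -addnS -dk ek.
by rewrite deg_addm.
Qed.

End Quotient.

(** * Action of the matrix units *)

Section PiFormulas.
Variables (F : fieldType) (n : nat) (c : F) (S : {set 'I_n}) (a : 'I_n -> F).
Implicit Types (A B : 'M[F]_n.+1) (f : ser F n) (r s : 'I_n).

Lemma pi_sumE A f : pi c S a A f =
  \sum_(i < n) \sum_(j < n | i != j)
     A (inord i) (inord j) *: Xop S a i (Pop S a j f)
  + \sum_(i < n) A (inord i) ord_max *: Xop S a i (Dcop c S a f)
  - \sum_(i < n) A ord_max (inord i) *: Pop S a i f
  + \sum_(i < n) A (inord i) (inord i) *: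
      (Xop S a i (Pop S a i f) + Dcop c S a f).
Proof.
apply: serP => k; rewrite !serE !ser_sumE /pi.
by under [X in _ = X + _ - _ + _]eq_bigr do rewrite ser_sumE.
Qed.

Lemma pi_linear f x A B : pi c S a (x *: A + B) f = x *: pi c S a A f + pi c S a B f.
Proof.
rewrite !pi_sumE !scalerDr scalerN !scaler_sumr.
rewrite [RHS]addrACA [X in _ = X + _]addrACA [X in _ = X + _ + _]addrACA.
rewrite -opprD -!big_split /=.
congr (_ + _); first (congr (_ + _); [|congr (- _)]); apply: eq_bigr => i _.
- rewrite scaler_sumr -big_split /=; congr (_ + _); first apply: eq_bigr => j _;
  by rewrite !mxE scalerDl scalerA.
- by rewrite !mxE scalerDl scalerA.
- by rewrite !mxE scalerDl scalerA.
Qed.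

Lemma piD f A B : pi c S a (A + B) f = pi c S a A f + pi c S a B f.
Proof. by have := pi_linear f 1 A B; rewrite !scale1r. Qed.

Lemma pi0 f : pi c S a 0 f = 0.
Proof. by apply: (addrI (pi c S a 0 f)); rewrite -piD !addr0. Qed.

Lemma piN f A : pi c S a (- A) f = - pi c S a A f.
Proof. by apply: (addrI (pi c S a A f)); rewrite -piD !subrr pi0. Qed.

Lemma piZ f x A : pi c S a (x *: A) f = x *: pi c S a A f.
Proof. by have := pi_linear f x A 0; rewrite pi0 !addr0. Qed.

Lemma EmxE (p q r s : nat) : (p <= n)%N -> (q <= n)%N -> (r <= n)%N -> (s <= n)%N ->
  Emx F n r s (inord p) (inord q) = ((p == r) && (q == s))%:R.
Proof. by move=> *; rewrite mxE -!val_eqE /= !inordK. Qed.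

Let ordE : ord_max = inord n :> 'I_n.+1.
Proof. by apply: val_inj; rewrite /= inordK. Qed.

Let leI r : (r <= n)%N := ltnW (ltn_ord r).
Let neI r : ((r : nat) == n) = false := ltn_eqF (ltn_ord r).
Let neI' r : (n == r) = false.
Proof. by rewrite eq_sym neI. Qed.

Let delta (M : lmodType F) r (G : 'I_n -> M) :
  \sum_(i < n) ((i : nat) == r)%:R *: G i = G r.
Proof.
rewrite (bigD1 r) //= eqxx scale1r big1 ?addr0 // => i ir.
by rewrite (inj_eq val_inj) (negPf ir) scale0r.
Qed.

(** The extension of the representation to all matrices sends the last diagonal unit to zero, so a
    diagonal unit acts as its difference with that one; hence the summand with [D + c]. *)
Lemma pi_Emx r s f : pi c S a (Emx F n r s) f =
  Xop S a r (Pop S a s f) + (r == s)%:R *: Dcop c S a f.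
Proof.
rewrite pi_sumE ordE [X in _ + X - _ + _]big1 => [|i _]; last first.
  by rewrite EmxE // neI' andbF scale0r.
rewrite [X in _ - X + _]big1 => [|i _]; last by rewrite EmxE // neI' scale0r.
rewrite subr0 addr0.
have -> : \sum_(i < n) Emx F n r s (inord i) (inord i) *:
     (Xop S a i (Pop S a i f) + Dcop c S a f) =
   (r == s)%:R *: (Xop S a r (Pop S a r f) + Dcop c S a f).
  rewrite -(delta r (fun i => (i == s)%:R *: (_ + _))); apply: eq_bigr => i _.
  by rewrite EmxE // scalerA -natrM mulnb.
have -> : \sum_(i < n) \sum_(j < n | i != j) Emx F n r s (inord i) (inord j) *:
     Xop S a i (Pop S a j f) = (r != s)%:R *: Xop S a r (Pop S a s f).
  rewrite -(delta r (fun i => (i != s)%:R *: Xop S a i (Pop S a s f))).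
  apply: eq_bigr => i _; rewrite big_mkcond /= -(delta s (fun j => (i != j)%:R *: _)).
  rewrite scaler_sumr; apply: eq_bigr => j _; rewrite EmxE //.
  case: (i != j); rewrite /= ?scale0r ?scaler0 // scale1r.
  by rewrite scalerA -natrM mulnb.
by case: eqP => [->|_]; rewrite /= ?scale1r !scale0r ?add0r ?addr0.
Qed.

Lemma pi_Emx_last r f : pi c S a (Emx F n r n) f = Xop S a r (Dcop c S a f).
Proof.
rewrite pi_sumE ordE big1 => [|i _]; last first.
  by rewrite big1 // => j _; rewrite EmxE // neI andbF scale0r.
rewrite add0r [X in _ - X + _]big1 => [|i _]; last by rewrite EmxE // neI' scale0r.
rewrite [X in _ + X]big1 => [|i _]; last by rewrite EmxE // neI andbF scale0r.
rewrite subr0 addr0 -(delta r (fun i => Xop S a i (Dcop c S a f))).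
by apply: eq_bigr => i _; rewrite EmxE // eqxx andbT.
Qed.

Lemma pi_last_Emx r f : pi c S a (Emx F n n r) f = - Pop S a r f.
Proof.
rewrite pi_sumE ordE big1 => [|i _]; last first.
  by rewrite big1 // => j _; rewrite EmxE // neI scale0r.
rewrite add0r big1 => [|i _]; last by rewrite EmxE // neI scale0r.
rewrite [X in _ + X]big1 => [|i _]; last by rewrite EmxE // neI scale0r.
rewrite sub0r addr0 -(delta r (fun i => Pop S a i f)); congr (- _).
by apply: eq_bigr => i _; rewrite EmxE // eqxx.
Qed.

Lemma pi_last_last f : pi c S a (Emx F n n n) f = 0.
Proof.
rewrite pi_sumE ordE big1 => [|i _]; last first.
  by rewrite big1 // => j _; rewrite EmxE // neI scale0r.
rewrite add0r big1 => [|i _]; last by rewrite EmxE // neI scale0r.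
rewrite [X in _ + X]big1 => [|i _]; last by rewrite EmxE // neI scale0r.
by rewrite sub0r addr0 big1 ?oppr0 // => i _; rewrite EmxE // neI andbF scale0r.
Qed.

End PiFormulas.

(** * Generators of the symplectic algebra *)

Section SpGenerators.
Variables (F : fieldType) (m n : nat).
Implicit Types (r s : nat).

Let mem_idx r s : (r <= m)%N -> (s <= m)%N -> (r, s) \in idx_pairs m.
Proof.
move=> rm sm; apply: (@allpairs_f _ _ _ (fun r s => (r, s)));
  by rewrite mem_iota add0n ltnS.
Qed.

Lemma sp_upper r s : (r <= m)%N -> (s <= m)%N ->
  Emx F n r (m.+1 + s) + Emx F n s (m.+1 + r) \in sp F m n.
Proof.
wlog rs : r s / (r <= s)%N => [th|] rm sm.
  by case/orP: (leq_total r s) => h; [|rewrite addrC]; apply: th.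
apply: memv_span; rewrite !mem_cat; apply/orP; left.
apply/mapP; exists (r, s) => //.
by rewrite mem_filter rs mem_idx.
Qed.

Lemma sp_lower r s : (r <= m)%N -> (s <= m)%N ->
  Emx F n (m.+1 + r) s + Emx F n (m.+1 + s) r \in sp F m n.
Proof.
wlog rs : r s / (r <= s)%N => [th|] rm sm.
  by case/orP: (leq_total r s) => h; [|rewrite addrC]; apply: th.
apply: memv_span; rewrite !mem_cat; apply/orP; right; apply/orP; left.
apply/mapP; exists (r, s) => //.
by rewrite mem_filter rs mem_idx.
Qed.

Lemma sp_diag r s : (r <= m)%N -> (s <= m)%N ->
  Emx F n r s - Emx F n (m.+1 + s) (m.+1 + r) \in sp F m n.
Proof.
move=> rm sm; apply: memv_span; rewrite !mem_cat; apply/orP; right; apply/orP; right.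
by apply/mapP; exists (r, s) => //; apply: mem_idx.
Qed.

End SpGenerators.

(** * Submodules as stable subspaces *)

Section Contact.
Variables (F : fieldType) (m : nat).
Hypothesis charF0 : [pchar F] =i pred0.
Local Notation n := (2 * m).+1.
Implicit Types (u v : 'I_n) (f : ser F n).

Definition ctv : 'I_n := inord m.

Definition partner u : 'I_n :=
  inord (if (u < m)%N then m.+1 + u else if (m < u)%N then u - m.+1 else m)%N.

(** This sign lets a single formula cover generators from both halves of the symplectic basis. *)
Definition half_sign u : F := if (u < m)%N then -1 else 1.

Lemma ctvE : ctv = m :> nat.
Proof. by rewrite inordK //; lia. Qed.

Lemma neq_ctv u : (u != ctv) = ((u < m) || (m < u))%N.
Proof. by rewrite -val_eqE /= ctvE neq_ltn. Qed.

Lemma partner_lt u : (u < m)%N -> partner u = (m.+1 + u)%N :> nat.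
Proof. by move=> um; rewrite /partner um inordK //; lia. Qed.

Lemma partner_gt u : (m < u)%N -> partner u = (u - m.+1)%N :> nat.
Proof.
move=> um; have un := ltn_ord u.
by rewrite /partner ltnNge (ltnW um) um inordK //=; lia.
Qed.

Lemma partner_ctv : partner ctv = ctv.
Proof. by apply: val_inj; rewrite /= /partner ctvE ltnn inordK //; lia. Qed.

Lemma partnerK : involutive partner.
Proof.
move=> u; have un := ltn_ord u; apply: val_inj => /=.
have [um|mu|e] := ltngtP u m.
- by rewrite partner_gt partner_lt //; lia.
- by rewrite partner_lt partner_gt //; lia.
- have -> : u = ctv by apply: val_inj; rewrite /= e ctvE.
  by rewrite !partner_ctv.
Qed.

Lemma half_signN u : u != ctv -> half_sign (partner u) = - half_sign u.
Proof.
rewrite neq_ctv => /orP[um|mu]; have un := ltn_ord u; rewrite /half_sign.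
  by rewrite partner_lt // um opprK; case: ifP => //; lia.
rewrite partner_gt // [(u < m)%N]ltnNge (ltnW mu) /=; case: ifP => //; lia.
Qed.

Lemma half_sign2 u : half_sign u * half_sign u = 1.
Proof. by rewrite /half_sign; case: ifP; rewrite ?mulr1 ?mulrNN ?mulr1. Qed.

Variables (c : F) (S : {set 'I_n}) (a : 'I_n -> F) (W : ser F n -> Prop).
Hypotheses (tS : ctv \notin S) (at0 : a ctv = 0).

(** Each operator is the image of one generator, up to sign and a factor 2. The last row supplies
    [P_u], the last column [X_u (D + c)], and the half containing [u] decides between a diagonal and
    an off-diagonal block. *)
Lemma submodule_stable : is_submodule m c S a W ->
  stable ctv partner half_sign c S a W.
Proof.
case=> Wp W0 WD WZ Wpi.
have WN f : W (- f) -> W f.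
  by move=> /(WZ (-1)) h; rewrite -[f]opprK -scaleN1r.
have W2 f : W (f + f) -> W f.
  move=> /(WZ 2%:R^-1) h; suff -> : f = 2%:R^-1 *: (f + f) by [].
  rewrite -mulr2n -scaler_nat scalerA mulVf ?scale1r //.
  exact: (natS_neq0 charF0).
have Xt f : Xop S a ctv f = mulx ctv f by apply: Xop_notin.
have Pt f : Pop S a ctv f = der ctv f by rewrite Pop_notin // at0 scale0r addr0.
have nE : (m.+1 + m)%N = n by lia.
have gtE u : (m < u)%N -> (m.+1 + partner u)%N = u.
  by move=> mu; rewrite partner_gt //; lia.
have le_partner u : (m < u)%N -> (partner u <= m)%N.
  by move=> mu; have := ltn_ord u; rewrite partner_gt //; lia.
have Epi A f g : W f -> A \in sp F m n -> pi c S a A f = g -> W g.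
  by move=> Wf Asp <-; apply: Wpi.
have Emt r : Emx F n r m = Emx F n r ctv by rewrite ctvE.
have Etm r : Emx F n m r = Emx F n ctv r by rewrite ctvE.
split.
- exact: W0.
- exact: WD.
- exact: WZ.
- move=> f Wf; apply: W2; apply: WN.
  apply: (Epi _ _ _ Wf (sp_lower F n (leqnn m) (leqnn m))).
  by rewrite nE Emt piD pi_last_Emx Pt opprD.
- move=> f Wf; apply: W2.
  apply: (Epi _ _ _ Wf (sp_upper F n (leqnn m) (leqnn m))).
  by rewrite nE Etm piD pi_Emx_last Xt.
- move=> u f ut Wf; have put := star_neqt partnerK partner_ctv ut.
  move: (ut); rewrite neq_ctv => /orP[um|mu]; rewrite /half_sign.
    rewrite um scaleN1r; apply: WN.
    apply: (Epi _ _ _ Wf (sp_lower F n (ltnW um) (leqnn m))).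
    rewrite nE -(partner_lt um) Emt piD pi_last_Emx pi_Emx (negPf put).
    by rewrite scale0r addr0 Pt opprB.
  rewrite ltnNge (ltnW mu) scale1r.
  apply: (Epi _ _ _ Wf (sp_diag F n (le_partner _ mu) (leqnn m))).
  rewrite nE gtE // Emt piD piN pi_last_Emx pi_Emx (negPf put).
  by rewrite scale0r addr0 Pt opprK addrC.
- move=> u f ut Wf; move: (ut); rewrite neq_ctv => /orP[um|mu]; rewrite /half_sign.
    rewrite um scaleN1r.
    apply: (Epi _ _ _ Wf (sp_diag F n (leqnn m) (ltnW um))).
    rewrite nE -(partner_lt um) Etm piD piN pi_Emx_last pi_Emx.
    by rewrite eq_sym (negPf ut) scale0r addr0 Xt.
  rewrite ltnNge (ltnW mu) scale1r.
  apply: (Epi _ _ _ Wf (sp_upper F n (le_partner _ mu) (leqnn m))).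
  rewrite nE gtE // Etm piD pi_Emx_last pi_Emx.
  by rewrite eq_sym (negPf ut) scale0r addr0 Xt addrC.
move=> u v f ut vt Wf.
have Qsp : Emx F n u v - (half_sign u * half_sign v) *: Emx F n (partner v) (partner u)
    \in sp F m n.
  move: ut vt; rewrite !neq_ctv /half_sign => /orP[um|mu] /orP[vm|mv].
  - rewrite um vm mulrNN mulr1 scale1r !partner_lt //.
    by apply: sp_diag; apply: ltnW.
  - rewrite um ltnNge (ltnW mv) mulr1 scaleN1r opprK -{1}(gtE v mv) (partner_lt um).
    by apply: sp_upper; rewrite ?(ltnW um) ?le_partner.
  - rewrite vm ltnNge (ltnW mu) mul1r scaleN1r opprK -{1}(gtE u mu) (partner_lt vm).
    by apply: sp_lower; rewrite ?(ltnW vm) ?le_partner.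
  - rewrite !ltnNge (ltnW mu) (ltnW mv) mulr1 scale1r -opprB memvN.
    rewrite -(gtE u mu) -(gtE v mv).
    by apply: sp_diag; apply: le_partner.
(* Both units are diagonal exactly when [u = v]; the sign product is then 1 and the two copies of
   [D + c] cancel. *)
apply: (Epi _ _ _ Wf Qsp); rewrite piD piN piZ !pi_Emx (inj_eq (inv_inj partnerK)).
rewrite [v == u]eq_sym; case: eqP => [<-|_]; last by rewrite !scale0r !addr0.
by rewrite half_sign2 !scale1r opprD addrACA subrr addr0.
Qed.

End Contact.

(** * Weights and their multiplicities *)

Section WeightModule.
Variables (F : fieldType) (m : nat).
Hypothesis charF0 : [pchar F] =i pred0.
Local Notation n := (2 * m).+1.
Variables (c : F) (S : {set 'I_n}).
Implicit Types (u s : 'I_n) (k : mon n) (f : ser F n).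

Lemma natr_char0_inj (x y : nat) : x%:R = y%:R :> F -> x = y.
Proof.
wlog xy : x y / (x <= y)%N => [th|].
  by case/orP: (leq_total x y) => h e; [|symmetry]; apply: th.
move/eqP; rewrite eq_sym -subr_eq0 -natrB //.
by have /pcharf0P-> := charF0; rewrite subn_eq0 => yx; apply/eqP; rewrite eqn_leq xy.
Qed.

Let xp k s : F := if s \in S then - (k s).+1%:R else (k s)%:R.

(** This is the weight of [x^k]. The last Cartan element involves the last diagonal unit, which acts
    by zero, so there [D + c] appears. *)
Let cw k (i : 'I_m.+1) : F := if (i < m)%N then xp k (inord i) - xp k (partner (inord i))
                  else xp k (ctv m) + (ev S k + c).

Lemma pi_cartan (i : 'I_m.+1) f k :
  pi c S (fun=> 0) (cartan_gen F m n i) f k = cw k i * f k.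
Proof.
rewrite /cw /cartan_gen; have [im|mi] := ltnP i m.
  have ii : (inord i : 'I_n) = i :> nat by rewrite inordK //; lia.
  have {1 2}<- := ii; have <- : partner (inord i : 'I_n) = (m.+1 + i)%N :> nat.
    by rewrite partner_lt ii.
  rewrite piD piN !pi_Emx !eqxx !scale1r opprD addrACA subrr addr0.
  by rewrite !serE !XPop0E mulrBl.
have im : i = m :> nat by have := ltn_ord i; lia.
have -> : (m.+1 + i)%N = n by lia.
have -> : (i : nat) = ctv m by rewrite im ctvE.
by rewrite piD piN pi_last_last pi_Emx eqxx scale1r subr0 serE XPop0E Dcop0E -mulrDl.
Qed.

Lemma in_span_mono (r : seq (mon n)) f :
  f = \sum_(k <- r) f k *: mono F k -> in_span (map (mono F) r) f.
Proof.
move=> e; exists (fun i => f (nth mon0 r i)); apply: serP => k.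
rewrite -(big_mkord xpredT
  (fun i => f (nth mon0 r i) * nth (zser F n) (map (mono F) r) i k)).
rewrite size_map {1}e ser_sumE (big_nth mon0) /=; apply: eq_big_nat => i /andP[_ ir].
by rewrite (nth_map mon0).
Qed.

(** With one more power of [t] than elements of [s], some nonzero linear form on those coefficients
    kills all of [s], but not a power of [t] on which it has a nonzero entry. *)
Lemma infinite_dimensional (s : seq (ser F n)) : exists f, polyn f /\ ~ in_span s f.
Proof.
pose z (j : 'I_(size s).+1) : mon n := [ffun i => if i == ctv m then val j else 0%N].
have z_inj : injective z.
  by move=> j l /ffunP/(_ (ctv m)); rewrite !ffunE eqxx => /val_inj.
pose A : 'M[F]_((size s).+1, size s) := \matrix_(j, i) nth (zser F n) s i (z j).
have : kermx A != 0.
  by rewrite -mxrank_eq0 mxrank_ker subn_eq0 -ltnNge ltnS rank_leq_col.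
move/rowV0Pn => [w /sub_kermxP wA /rV0Pn[j wj]].
exists (mono F (z j)); split; first exact: polyn_mono.
case=> y ey; case/eqP: wj.
have <- : \sum_l w 0 l * mono F (z j) (z l) = w 0 j.
  rewrite (bigD1 j) //= /mono eqxx mulr1 big1 ?addr0 // => l /negPf lj.
  by rewrite (inj_eq z_inj) lj mulr0.
rewrite ey; under eq_bigr do rewrite mulr_sumr.
rewrite exchange_big big1 //= => i _.
under eq_bigr do rewrite mulrCA.
rewrite -mulr_sumr; have /rowP/(_ i) := wA; rewrite !mxE => e.
rewrite -[RHS](mulr0 (y i)); congr (_ * _); rewrite -[RHS]e.
by apply: eq_bigr => l _; rewrite mxE.
Qed.

Lemma weight_decomposition f : polyn f ->
  exists (r : nat) (lam : 'I_r -> 'I_m.+1 -> F) (g : 'I_r -> ser F n),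
    (forall j, weight_vec m c S (fun=> 0) (lam j) (g j)) /\
    f = (fun k => \sum_(j < r) g j k).
Proof.
case/polyn_sum => r _ e; exists (size r), (fun j => cw (nth mon0 r j)).
exists (fun j => f (nth mon0 r j) *: mono F (nth mon0 r j)); split=> [j|].
  split; first exact/polynZ/polyn_mono.
  move=> i; apply: serP => k; rewrite pi_cartan !serE /mono.
  by case: eqP => [->//|_]; rewrite !mulr0.
by apply: serP => k; rewrite {1}e ser_sumE (big_nth mon0) big_mkord.
Qed.

Hypotheses (tS : ctv m \notin S) (starS : forall u, u \in S -> partner u \notin S).

(** Exactly one of the partners lies in [S], so the difference of their eigenvalues is, up to sign,
    the sum of the two exponents plus one. *)
Lemma weight_pair k k' u : u \in S -> cw k =1 cw k' ->
  (k u + k (partner u) = k' u + k' (partner u))%N.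
Proof.
move=> uS ww; have psS := starS uS.
have : u != ctv m by apply: contraNneq tS => <-.
rewrite neq_ctv => /orP[um|mu].
  have uE : inord (Ordinal (leqW um)) = u by apply: val_inj; rewrite /= inordK.
  have := ww (Ordinal (leqW um)); rewrite /cw /= um uE /xp uS (negPf psS).
  rewrite -!opprD -!natrD => /oppr_inj/natr_char0_inj.
  by rewrite !addSn => -[].
have pum : (partner u < m)%N by have := ltn_ord u; rewrite partner_gt //; lia.
have uE : inord (Ordinal (leqW pum)) = partner u by apply: val_inj; rewrite /= inordK.
have := ww (Ordinal (leqW pum)); rewrite /cw /= pum uE partnerK /xp uS (negPf psS).
rewrite !opprK -!natrD => /natr_char0_inj.
by rewrite !addnS => -[e]; rewrite addnC e addnC.
Qed.

(** By [weight_pair] the exponents in [S] are bounded; the last weight fixes [k t + A k - C k],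
    which then bounds the others. *)
Lemma weight_bound k' : exists B, forall k, cw k =1 cw k' -> forall s, (k s <= B)%N.
Proof.
pose D := (\sum_s k' s)%N; pose A k := (\sum_s (if s \in S then 0 else k s))%N.
pose C k := (\sum_s (if s \in S then (k s).+1 else 0))%N.
have kD s : (k' s <= D)%N by rewrite /D (bigD1 s) //= leq_addr.
have evE k : ev S k = (A k)%:R - (C k)%:R :> F.
  rewrite /A /C !natr_sum -sumrB; apply: eq_bigr => s _.
  by case: ifP; rewrite ?sub0r ?subr0.
(* Exponents in [S] are at most [D + D], a sum of two exponents of [k'], so each of the [n] summands
   of [C k] is at most [(D + D).+1]. *)
exists (k' (ctv m) + A k' + n * (D + D).+1)%N => k ww s.
have kS u : u \in S -> (k u <= D + D)%N.
  move=> uS; apply: leq_trans (leq_addr (k (partner u)) _) _.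
  by rewrite (weight_pair uS ww) leq_add.
have Cb : (C k <= n * (D + D).+1)%N.
  rewrite -{1}[n]card_ord -sum_nat_const; apply: leq_sum => u _.
  by case: ifP => // /kS.
have [sS|sS] := boolP (s \in S).
  by have := kS _ sS; nia.
have ks : (k s <= A k)%N by rewrite /A (bigD1 s) //= (negPf sS) leq_addr.
have := ww ord_max; rewrite /cw /= ltnn /xp (negPf tS) !evE.
move/(congr1 (fun x => x - c + (C k)%:R + (C k')%:R)).
have e1 (x y z z' : F) : x + (y - z + c) - c + z + z' = x + y + z' by ring.
have e2 (x y z z' : F) : x + (y - z + c) - c + z' + z = x + y + z' by ring.
by rewrite e1 e2 -!natrD => /natr_char0_inj; lia.
Qed.

Lemma weight_spaces_fd (lam : 'I_m.+1 -> F) :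
  exists r, forall f, weight_vec m c S (fun=> 0) lam f -> in_span r f.
Proof.
have supp f k : weight_vec m c S (fun=> 0) lam f -> f k != 0 -> cw k =1 lam.
  move=> [_ wf] fk i; have := congr1 (fun g => g k) (wf i).
  by rewrite pi_cartan => /(mulIf fk).
have [[k0 k0lam]|nok] := pselect (exists k, cw k =1 lam); last first.
  exists [::] => f wf; apply: (@in_span_mono [::]); rewrite big_nil.
  apply: serP => k; apply/eqP; apply: contrapT => /negP fk.
  by apply: nok; exists k; apply: supp wf fk.
have [B Bk] := weight_bound k0.
exists (map (mono F) (box n B.+1)) => f wf; apply: in_span_mono.
apply: sum_mono; first exact: box_uniq.
move=> k; rewrite mem_box; apply: contraNeq => /(supp _ _ wf) klam.
by apply/forallP => s; rewrite ltnS Bk // => i; rewrite klam k0lam.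
Qed.

Lemma weight_module : inf_dim_weight_module_fd m c S (fun=> 0).
Proof.
split; [exact: infinite_dimensional|exact: weight_decomposition|].
exact: weight_spaces_fd.
Qed.

End WeightModule.

(** * Irreducibility and composition series *)

Section Conclusions.
Variables (F : fieldType) (m : nat).
Hypothesis charF0 : [pchar F] =i pred0.
Local Notation n := (2 * m).+1.
Implicit Types (c : F) (S : {set 'I_n}) (a : 'I_n -> F) (W V : ser F n -> Prop).

Lemma mono_neq0 k : mono F k <> 0 :> ser F n.
Proof.
move/(congr1 (fun f => f k)); rewrite /mono eqxx => /eqP.
by rewrite ser0E oner_eq0.
Qed.

Lemma submodule_polyn c S a W : is_submodule m c S a W -> forall f, W f -> polyn f.
Proof. by case. Qed.

Lemma irreducible_criterion c S a : ctv m \notin S -> a (ctv m) = 0 ->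
  (forall W, is_submodule m c S a W -> (exists f, W f /\ f <> 0) ->
     forall k, W (mono F k)) ->
  sp_irreducible m c S a.
Proof.
move=> tS at0 h; split.
  by exists (mono F mon0); split; [apply: polyn_mono|apply: mono_neq0].
move=> W sW; have [exf|nof] := pselect (exists f, W f /\ f <> 0); last first.
  by left=> f Wf; apply: contrapT => f0; apply: nof; exists f.
right=> f; apply: (stable_all (submodule_stable charF0 tS at0 sW)).
exact: h.
Qed.

Lemma untwisted_irreducible c S : ctv m \notin S ->
    (forall u, u \in S -> partner u \notin S) ->
    (forall k, ev S k + c != 0) -> sp_irreducible m c S (fun=> 0).
Proof.
move=> tS starS evc; apply: irreducible_criterion => // W sW exf k.
have stW := submodule_stable charF0 tS erefl sW.
apply: (untwisted_mono charF0 (@partnerK m) (partner_ctv m)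
  (@half_sign2 F m) stW (Q := fun=> True)) => //.
apply: (untwisted_mono0 charF0 (@partnerK m) (partner_ctv m)
  (@half_sign2 F m) stW) => //.
exact: submodule_polyn sW.
Qed.

Lemma twisted_irreducible c S a v : ctv m \notin S ->
    (forall u, u \in S -> partner u \notin S) -> a (ctv m) = 0 ->
    v \notin S -> a v != 0 -> partner v \in S \/ S = set0 ->
  sp_irreducible m c S a.
Proof.
move=> tS starS at0 vS av svS; apply: irreducible_criterion => // W sW exf k.
have vt : v != ctv m by apply: contraNneq av => ->; rewrite at0.
have stW := submodule_stable charF0 tS at0 sW.
apply: (twisted_mono charF0 (@partnerK m) (partner_ctv m) (@half_signN F m)
  (@half_sign2 F m) stW tS at0 vt) => //.
apply: (twisted_mono0 charF0 (@partnerK m) (partner_ctv m) (@half_signN F m)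
  (@half_sign2 F m) stW tS starS vt) => //.
exact: submodule_polyn sW.
Qed.

Lemma low_degree_submodule (K : nat) :
  is_submodule m (- K%:R) (set0 : {set 'I_n}) (fun=> 0) (sbnd (fun=> 1%N) K.+1 : ser F n -> Prop).
Proof.
split.
- by move=> f fK; apply/polynP; exists K.+1.
- by [].
- exact: sbndD.
- by move=> x f; apply: sbndZ.
move=> A f _ fK; rewrite pi_sumE.
have nS u : u \notin (set0 : {set 'I_n}) by rewrite inE.
have XP i j : sbnd (fun=> 1%N) K.+1 (Xop set0 (fun=> 0) i (Pop set0 (fun=> 0) j f)).
  by rewrite Pop_notin // Xop_notin // scale0r addr0; apply: sbnd_mulx_der.
(* [D - K] kills the top degree [K], which leaves room for the multiplication in [X_i (D - K)]. *)
have DK : sbnd (fun=> 1%N) K (Dcop (- K%:R) set0 (fun=> 0) f).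
  move=> k; rewrite Dcop0E leq_eqVlt => /orP[/eqP e|/fK->]; last by rewrite mulr0.
  by rewrite ev_set0 -e subrr mul0r.
apply: sbndD; first apply: sbndD; first apply: sbndD.
- by apply: sbnd_sum => i k kK; rewrite ser_sumE big1 // => j _; apply: sbndZ (XP i j) _ kK.
- apply: sbnd_sum => i; apply: sbndZ; rewrite Xop_notin //.
  by have := sbnd_mulx i DK; rewrite addn1.
- apply/sbndN/sbnd_sum => i; apply: sbndZ; rewrite Pop_notin // scale0r addr0.
  by apply: sbndW (sbnd_der i fK); rewrite leq_subr.
- apply: sbnd_sum => i; apply/sbndZ/sbndD; first exact: XP.
  exact: sbndW DK.
Qed.

Lemma deg_pure K (u : 'I_n) : wdeg (fun=> 1%N) (pure K u) = K.+1.
Proof.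
rewrite /wdeg (bigD1 u) //= ffunE eqxx mul1n big1 ?addn0 // => i /negPf iu.
by rewrite ffunE iu.
Qed.

Lemma composition_series (K : nat) : (0 < m)%N ->
  sp_comp_series_len2 m (- K%:R) (set0 : {set 'I_n}) (fun=> 0 : F).
Proof.
move=> m0; have nS u : u \notin (set0 : {set 'I_n}) by rewrite inE.
have ut0 : (ord0 : 'I_n) != ctv m by rewrite neq_ctv m0.
have stV V : is_submodule m (- K%:R) (set0 : {set 'I_n}) (fun=> 0) V -> _ :=
  submodule_stable charF0 (nS (ctv m)) erefl.
exists (sbnd (fun=> 1%N) K.+1); split.
- exact: low_degree_submodule.
- exists (mono F mon0); split; last exact: mono_neq0.
  by apply: sbndW (sbnd_mono _ mon0); rewrite wdeg_mon0.
- exists (mono F (pure K ord0)); split; first exact: polyn_mono.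
  move=> h; have := h (pure K ord0); rewrite deg_pure /mono eqxx => /(_ (leqnn _)) /eqP.
  by rewrite oner_eq0.
- move=> V sV VW; have [exf|nof] := pselect (exists f, V f /\ f <> 0); last first.
    by left=> f Vf; apply: contrapT => f0; apply: nof; exists f.
  right=> f fK; apply: (stable_span (stV V sV) (A := fun k => (wdeg (fun=> 1%N) k <= K)%N)).
  (* Here [Q] selects the degrees up to [K]; adjoining [t] starts from a degree below [K], where
     [D - K] is invertible. *)
  + apply: (untwisted_mono charF0 (@partnerK m) (partner_ctv m)
      (@half_sign2 F m) (stV V sV)).
    * move=> k; rewrite wdeg_addm addn1 ev_set0 => kK.
      rewrite -oppr_eq0 opprB -natrB ?(ltnW kK) //.
      by rewrite -(subnSK kK) natS_neq0.
    * by move=> k u; rewrite wdeg_addm addn1 => /ltnW.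
    * by move=> k u; rewrite !wdeg_addm.
    * by move=> k u; rewrite inE.
    apply: (untwisted_mono0 charF0 (@partnerK m) (partner_ctv m)
      (@half_sign2 F m) (stV V sV)) => //; first by move=> u k; rewrite inE.
    exact: submodule_polyn sV.
  + by apply/polynP; exists K.+1.
  + by move=> k /negP; rewrite -ltnNge => /fK.
move=> V sV WV; have [exf|nof] := pselect (exists f, V f /\ ~ sbnd (fun=> 1%N) K.+1 f);
  last by left=> f Vf; apply: contrapT => f0; apply: nof; exists f.
right=> f; apply: (stable_all (stV V sV)).
apply: (quotient_mono charF0 (@partnerK m) (partner_ctv m) (@half_signN F m)
      (@half_sign2 F m) (stV V sV) ut0) => //.
apply: (pure_in_stable charF0 (@partnerK m) (partner_ctv m) (@half_signN F m)
      (@half_sign2 F m) (stV V sV) ut0); first exact: submodule_polyn sV.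
apply: (head_degree_exists charF0 (@partnerK m) (partner_ctv m) (@half_signN F m)
      (@half_sign2 F m) (stV V sV) ut0) => //.
exact: submodule_polyn sV.
Qed.

Lemma ev_int S k : exists z : int, ev S k = z%:~R :> F.
Proof.
exists (\sum_s (if s \in S then - (k s).+1%:Z else (k s)%:Z)).
by rewrite raddf_sum; apply: eq_bigr => s _; case: ifP.
Qed.

End Conclusions.

Theorem theorem2 (F : fieldType) (charF0 : [pchar F] =i pred0)
  (m : nat) (hm : (1 <= m)%N) (n : nat) (hn : n = (2 * m).+1)
  (S : {set 'I_n})
  (hS1 : forall i : 'I_n, nat_of_ord i = m -> i \notin S)
  (hS2 : forall i j : 'I_n, (i < m)%N -> nat_of_ord j = (i + m.+1)%N ->
           ~~ ((i \in S) && (j \in S)))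
  (a : 'I_n -> F) :
  (* (i) *)
  (forall c : F, ~ (exists k : nat, c = - k%:R) ->
     sp_irreducible m c (set0 : {set 'I_n}) (fun _ : 'I_n => 0)) /\
  (forall c : F, (exists k : nat, c = - k%:R) ->
     sp_comp_series_len2 m c (set0 : {set 'I_n}) (fun _ : 'I_n => 0)) /\
  (* (ii) *)
  (S != set0 -> forall c : F, ~ (exists z : int, c = z%:~R) ->
     sp_irreducible m c S (fun _ : 'I_n => 0)) /\
  (* (iii) *)
  ((exists i : 'I_n, a i != 0) ->
   (forall i : 'I_n, nat_of_ord i = m -> a i = 0) ->
   ((exists j : 'I_n, (m < j)%N && (j \in S)) ->
      exists i0 j0 : 'I_n, [/\ nat_of_ord j0 = (i0 + m.+1)%N, j0 \in S
                             & a i0 != 0]) ->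
   ((exists j : 'I_n, (j <= m)%N && (j \in S)) ->
      exists j0 k0 : 'I_n, [/\ j0 \in S, (j0 <= m)%N,
                             nat_of_ord k0 = (j0 + m.+1)%N & a k0 != 0]) ->
   forall c : F, sp_irreducible m c S a) /\
  (* (iv) *)
  (forall c : F, inf_dim_weight_module_fd m c S (fun _ : 'I_n => 0)).
Proof.
subst n; have tS : ctv m \notin S by apply: hS1; rewrite ctvE.
have pE (i j : 'I_(2 * m).+1) :
    nat_of_ord j = (i + m.+1)%N -> partner i = j /\ partner j = i.
  move=> ji; have jn := ltn_ord j; have im : (i < m)%N by lia.
  suff e : partner i = j by rewrite -e partnerK.
  by apply: val_inj; rewrite /= partner_lt // ji addnC.
have starS u : u \in S -> partner u \notin S.
  move=> uS; have : u != ctv m by apply: contraNneq tS => <-.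
  rewrite neq_ctv => /orP[um|mu].
    by have := hS2 u (partner u) um; rewrite uS partner_lt // addnC; apply.
  have un := ltn_ord u; have := hS2 (partner u) u; rewrite uS andbT partner_gt //.
  by apply; lia.
split; [|split; [|split; [|split]]].
- move=> c hc; apply: untwisted_irreducible => //; try by move=> *; rewrite inE.
  move=> k; rewrite ev_set0; apply: contra_notN hc => /eqP e.
  by exists (wdeg (fun=> 1%N) k); apply/eqP; rewrite -addr_eq0 addrC e.
- by move=> c [K ->]; apply: composition_series.
- move=> _ c hc; apply: untwisted_irreducible => // k.
  have [z ->] := ev_int F S k; apply: contra_notN hc => /eqP e.
  by exists (- z); apply/eqP; rewrite raddfN -addr_eq0 addrC e.
- move=> [v av] at0 hi hj c.
  have {}at0 : a (ctv m) = 0 by apply: at0; rewrite ctvE.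
  (* For empty [S] any [v] with [a v != 0] serves; otherwise the half met by [S] supplies one whose
     partner is in [S]. *)
  have [S0|[j jS]] := set_0Vmem S.
    by apply: (twisted_irreducible charF0 c (v := v)) => //; [rewrite S0 inE|right].
  have irr (i l : 'I_(2 * m).+1) : partner i = l -> l \in S -> a i != 0 ->
      sp_irreducible m c S a.
    move=> pil lS ai; apply: (twisted_irreducible charF0 c (v := i)) => //.
      by rewrite -(partnerK i) pil starS.
    by left; rewrite pil.
  have [jm|mj] := leqP j m.
    have [|j0 [k0 [j0S _ /pE[_ pk] ak]]] := hj; first by exists j; rewrite jm.
    exact: irr pk j0S ak.
  have [|i0 [j0 [/pE[pi _] j0S ai]]] := hi; first by exists j; rewrite mj.
  exact: irr pi j0S ai.
- by move=> c; apply: weight_module.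
Qed.
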